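(* Let $n\ge 2$ and let $\mu$ be a locally finite Borel measure on $\mathbb{R}^n$. Then there exists a constant $C=C_n$ depending only on the dimension $n$ (in particular independent of $\mu$) such that $$\int_{\mathbb{R}^n}|u|\,d\mu\le C\int_{\mathbb{R}^n}|\nabla u(x)|\,\mathrm{M}_1\mu(x)\,dx\qquad\text{for all } u\in \mathrm{Lip}_c(\mathbb{R}^n).$$
   Context: A locally finite Borel measure on $\mathbb{R}^n$ is a positive Borel measure $\mu$ with $\mu(K)<\infty$ for every compact $K$. $\mathcal{L}$ denotes Lebesgue measure and $B_r(x)$ the Euclidean ball of center $x$ and radius $r$. For $0\le\alpha<n$ the fractional maximal function of $\mu$ is $$\mathrm{M}_\alpha\mu(x)=\sup_{r>0} r^\alpha\,\frac{\mu(B_r(x))}{\mathcal{L}(B_r(x))}\in[0,\infty].$$ $\mathrm{Lip}_c(\mathbb{R}^n)$ is the space of compactly supported Lipschitz functions on $\mathbb{R}^n$. In integrals the convention $0\cdot\infty=0$ is used. *)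

(* Defs.v *)
From HB Require Import structures.
From mathcomp Require Import all_boot all_order all_algebra.
From mathcomp Require Import all_classical all_reals all_analysis.
From mathcomp Require Import measurable_realfun.

Set Implicit Arguments.
Unset Strict Implicit.
Unset Printing Implicit Defensive.
Import Order.TTheory GRing.Theory Num.Theory.
Import numFieldTopology.Exports numFieldNormedType.Exports.

Local Open Scope classical_set_scope.
Local Open Scope ring_scope.

(* R^n is 'rV[R]_n. MathComp-Analysis equips it with the product topology
   (metrized by the sup norm) but with no measurable structure; the one below
   is the Borel sigma-algebra. *)
Section borel_mx.
Variables (R : realType) (m n : nat).

Let T := g_sigma_algebraType (@open 'M[R]_(m, n)).

HB.instance Definition _ :=
  @isMeasurable.Build ((@open 'M[R]_(m, n)).-sigma)%mdisp 'M[R]_(m, n)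
    (@measurable _ T) (@measurable0 _ T) (@measurableC _ T)
    (@bigcupT_measurable _ T).

Lemma open_measurable_mx (U : set 'M[R]_(m, n)) : open U -> measurable U.
Proof. by move=> oU; exact: sub_sigma_algebra. Qed.

End borel_mx.

Section lebesgue_rV.
Context {R : realType}.

Definition cons_rV n (p : measurableTypeR R * 'rV[R]_n) : 'rV[R]_n.+1 :=
  row_mx (p.1%:M : 'rV[R]_1) p.2.

(* Lebesgue measure on the Borel sets of R^n: n-fold product of the
   one-dimensional Lebesgue measure (see lebesgue_rV_box). *)
Fixpoint lebesgue_rV (n : nat) : set 'rV[R]_n -> \bar R :=
  match n with
  | 0 => \d_(0 : 'rV[R]_0)
  | n'.+1 =>
      pushforward (@lebesgue_measure R \x lebesgue_rV (n := n'))%E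
        (@cons_rV n')
  end.

Lemma cons_rV0 n p : @cons_rV n p 0 ord0 = p.1.
Proof.
have -> : @ord0 n = lshift n (@ord0 0) :> 'I_(1 + n) by apply: val_inj.
by rewrite [LHS]row_mxEl mxE eqxx.
Qed.

Lemma cons_rVS n p i : @cons_rV n p 0 (lift ord0 i) = p.2 0 i.
Proof.
have -> : lift (@ord0 n) i = rshift 1 i :> 'I_(1 + n) by apply: val_inj.
by rewrite [LHS]row_mxEr.
Qed.

Lemma open_rV_bigcup n (U : set 'rV[R]_n) : open U ->
  U = \bigcup_(q : 'rV[rat]_n * nat)
        (if `[< ball (map_mx ratr q.1 : 'rV[R]_n) q.2.+1%:R^-1 `<=` U >]
         then ball (map_mx ratr q.1 : 'rV[R]_n) q.2.+1%:R^-1 else set0).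
Proof.
move=> oU; apply/seteqP; split=> [x Ux|x [q _]]; last by case: asboolP => // + ?; apply.
have /nbhs_ballP[e /= e0 eU] := open_nbhs_nbhs (conj oU Ux).
have [k ke] : exists k : nat, (k.+1%:R^-1 : R) < e / 2.
  have e20 : 0 < e / 2 by rewrite divr_gt0.
  have [k _ /(_ k (leqnn _))] := near_infty_natSinv_lt (PosNum e20).
  by exists k.
have kp : (0 : R) < k.+1%:R^-1 by rewrite invr_gt0.
have /choice[q qP] : forall i : 'I_n, exists q : rat,
    ratr q \in `]x 0 i - k.+1%:R^-1, x 0 i + k.+1%:R^-1[.
  move=> i; apply: rat_in_itvoo.
  by rewrite ltrBlDr -addrA ltrDl addr_gt0.
have qx : ball (map_mx ratr (\row_i q i) : 'rV[R]_n) k.+1%:R^-1 x.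
  split=> // i j; rewrite ord1 !mxE /ball /= ltr_distl.
  by have := qP j; rewrite in_itv.
exists (\row_i q i, k) => //=; rewrite ifT //; apply/asboolP.
move=> y qy; apply: eU; rewrite (splitr e).
apply: (@ball_triangle _ _ (map_mx ratr (\row_i q i) : 'rV[R]_n)).
  by apply/ball_sym/(le_ball (ltW ke)).
exact/(le_ball (ltW ke)).
Qed.

Lemma preimage_cons_rV_ball n (c : 'rV[R]_n.+1) (r : R) :
  @cons_rV n @^-1` ball c r =
    ball (c 0 ord0) r `*` ball (\row_i c 0 (lift ord0 i) : 'rV[R]_n) r.
Proof.
apply/seteqP; split=> [p [r0 pr]|p [p1 [r0 p2]]].
  split.
    by have := pr 0 ord0; rewrite cons_rV0.
  by split=> // i j; have := pr 0 (lift ord0 j); rewrite cons_rVS mxE ord1.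
split=> // i j; rewrite ord1; case: (unliftP ord0 j) => [j' ->|->].
  by rewrite cons_rVS; have := p2 0 j'; rewrite mxE.
by rewrite cons_rV0.
Qed.

Lemma measurable_cons_rV n : measurable_fun setT (@cons_rV n).
Proof.
apply: (@measurability _ _ _ _ _ _ (@open 'rV[R]_n.+1)) => //.
move=> _ [U oU <-]; rewrite setTI [in X in _ @^-1` X](open_rV_bigcup oU).
rewrite preimage_bigcup; apply: countable_bigcupT_measurable => // q.
case: ifPn => _; last by rewrite preimage_set0.
rewrite preimage_cons_rV_ball; apply: measurableX.
  by apply: open_measurable; exact: ball_open.
by apply: open_measurable_mx; exact: ball_open.
Qed.

Lemma measurable_coord_rV n (i : 'I_n) :
  measurable_fun setT (fun v : 'rV[R]_n => v 0 i : measurableTypeR R).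
Proof.
apply: (@measurability _ _ _ _ _ _ (@RGenOpens.G R)).
  exact: RGenOpens.measurableE.
move=> _ [_ [a [b ->]] <-]; rewrite setTI.
apply: open_measurable_mx; apply: open_comp; last exact: interval_open.
by move=> v _; exact: coord_continuous.
Qed.

Lemma measurable_box_rV n (A : 'I_n -> set (measurableTypeR R)) :
  (forall i, measurable (A i)) ->
  measurable [set v : 'rV[R]_n | forall i, A i (v 0 i)].
Proof.
move=> mA.
rewrite (_ : mkset _ =
    \bigcap_(i in [set: 'I_n]) (fun v : 'rV[R]_n => v 0 i) @^-1` A i).
  apply: fin_bigcap_measurable => // i _; rewrite -[X in measurable X]setTI.
  exact: measurable_coord_rV.
by apply/seteqP; split=> [v Av i _|v Av i]; exact: Av.
Qed.

Lemma preimage_cons_rV_box n (A : 'I_n.+1 -> set (measurableTypeR R)) :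
  @cons_rV n @^-1` [set v : 'rV[R]_n.+1 | forall i, A i (v 0 i)] =
    A ord0 `*` [set v : 'rV[R]_n | forall i, A (lift ord0 i) (v 0 i)].
Proof.
apply/seteqP; split=> [p Ap|p [p1 p2] i].
  by split=> [|i]; [rewrite -cons_rV0|rewrite -cons_rVS]; exact: Ap.
by case: (unliftP ord0 i) => [j ->|->]; rewrite ?cons_rVS ?cons_rV0.
Qed.

Let lebesgue_rV_measure n (m : {sigma_finite_measure set 'rV[R]_n -> \bar R}) :
  {measure set 'rV[R]_n.+1 -> \bar R} :=
  measure_function_pushforward__canonical__measure_function_Measure
    (@lebesgue_measure R \x m)%E (@measurable_cons_rV n).

Lemma lebesgue_rV_ext n :
  exists m : {sigma_finite_measure set 'rV[R]_n -> \bar R},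
    @lebesgue_rV n = m /\
    forall A : 'I_n -> set (measurableTypeR R), (forall i, measurable (A i)) ->
      m [set v : 'rV[R]_n | forall i, A i (v 0 i)] =
        (\prod_(i < n) @lebesgue_measure R (A i))%E.
Proof.
elim: n => [|n [m [mE mbox]]].
  exists (\d_(0 : 'rV[R]_0)); split=> // A _.
  by rewrite big_ord0 /= diracE mem_set// => -[].
pose m' := lebesgue_rV_measure m.
have m'box (A : 'I_n.+1 -> set (measurableTypeR R)) :
    (forall i, measurable (A i)) ->
    m' [set v : 'rV[R]_n.+1 | forall i, A i (v 0 i)] =
      (\prod_(i < n.+1) @lebesgue_measure R (A i))%E.
  move=> mA; rewrite /m' /lebesgue_rV_measure /= /pushforward.
  rewrite preimage_cons_rV_box product_measure1E//; last first.
    by apply: (@measurable_box_rV n (fun i => A (lift ord0 i))) => i; exact: mA.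
  by rewrite (mbox (fun i => A (lift ord0 i)))// big_ord_recl.
have sm' : sigma_finite setT m'.
  pose B k : 'I_n.+1 -> set (measurableTypeR R) :=
    fun=> `[- k%:R, k%:R]%classic.
  exists (fun k => [set v : 'rV[R]_n.+1 | forall i, B k i (v 0 i)]) => [|k].
    apply/esym/seteqP; split=> // v _.
    have [k kv] : exists k : nat, `|v| <= k%:R.
      by exists (Num.truncn `|v|).+1; rewrite ltW// truncnS_gt.
    exists k => // i; rewrite /B /= in_itv /= -ler_norml.
    apply: le_trans kv; rewrite [leRHS]mx_normrE.
    exact: (le_bigmax _ (fun ij : 'I_1 * 'I_n.+1 => `|v ij.1 ij.2|) (ord0, i)).
  have mB i : measurable (B k i) by exact: measurable_itv.
  split; first exact: (measurable_box_rV mB).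
  rewrite m'box// ltey_eq; apply/orP; left.
  elim/big_ind : _ => // [x y xfin yfin|i _]; first exact: fin_numM.
  by rewrite /= lebesgue_measure_itv /=; case: ifP.
pose sfm := Measure_isSigmaFinite.Build _ _ _ m' sm'.
pose M : {sigma_finite_measure set 'rV[R]_n.+1 -> \bar R} :=
  HB.pack (Measure.sort m') (Measure.class m') sfm.
exists M; split=> //.
by rewrite /= mE.
Qed.

Let lebesgue_rV0 n : @lebesgue_rV n set0 = 0%E.
Proof. by have [m [-> _]] := lebesgue_rV_ext n; exact: measure0. Qed.

Let lebesgue_rV_ge0 n A : (0 <= @lebesgue_rV n A)%E.
Proof. by have [m [-> _]] := lebesgue_rV_ext n; exact: measure_ge0. Qed.

Let lebesgue_rV_semi_sigma_additive n : semi_sigma_additive (@lebesgue_rV n).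
Proof.
have [m [-> _]] := lebesgue_rV_ext n; exact: measure_semi_sigma_additive.
Qed.

HB.instance Definition _ n := isMeasure.Build _ _ _ (@lebesgue_rV n)
  (@lebesgue_rV0 n) (@lebesgue_rV_ge0 n) (@lebesgue_rV_semi_sigma_additive n).

Let lebesgue_rV_sigma_finite n : sigma_finite setT (@lebesgue_rV n).
Proof. by have [m [-> _]] := lebesgue_rV_ext n; exact: sigma_finiteT. Qed.

HB.instance Definition _ n := Measure_isSigmaFinite.Build _ _ _
  (@lebesgue_rV n) (@lebesgue_rV_sigma_finite n).

Lemma lebesgue_rV_box n (A : 'I_n -> set (measurableTypeR R)) :
  (forall i, measurable (A i)) ->
  lebesgue_rV [set v : 'rV[R]_n | forall i, A i (v 0 i)] =
    (\prod_(i < n) @lebesgue_measure R (A i))%E.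
Proof. by have [m [-> +]] := lebesgue_rV_ext n; exact. Qed.

End lebesgue_rV.
Arguments lebesgue_rV {R n}.

Section euclidean.
Context {R : realType} {n : nat}.
Implicit Types (x y : 'rV[R]_n) (r : R) (u : 'rV[R]_n -> R).
Implicit Types mu : {measure set 'rV[R]_n -> \bar R}.

(* The library norm `|x| on 'rV[R]_n is the sup norm. *)
Definition eucl_norm x : R := Num.sqrt (\sum_i x 0 i ^+ 2).

Definition eucl_ball x r : set 'rV[R]_n := [set y | eucl_norm (y - x) < r].

Definition locally_finite mu :=
  forall K : set 'rV[R]_n, compact K -> (mu K < +oo)%E.

Definition frac_maximal (alpha : R) mu x : \bar R :=
  ereal_sup [set ((r `^ alpha)%:E *
                  (mu (eucl_ball x r) / lebesgue_rV (eucl_ball x r)))%E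
            | r in [set r : R | 0 < r]].

Definition lip_c u :=
  (exists L : R, forall x y, `|u x - u y| <= L * eucl_norm (x - y)) /\
  compact (closure [set x | u x != 0]).

(* Vector of partial derivatives. 'D_v u x is a total operator whose value is
   arbitrary where the limit does not exist; for Lipschitz u this concerns a
   Lebesgue-null set only. *)
Definition grad u x : 'rV[R]_n := \row_i 'D_(delta_mx 0 i) u x.

End euclidean.

(* Main.v *)
(* The idea is the boxing inequality, made quantitative in the weight and
   applied to the level sets of [u]. Fix [t >= 0] and let [E = {|u| > t}].
   Around a point of [{|u| >= t + e}] small cubes lie in [E] and large ones do
   not, so doubling the side until the density of [E] drops below 1/2 yields a
   cube [Q] of side [2 r] in which [E] and its complement both have density
   bounded below. For small [d] the layer [{t < |u| < t + d}] is negligible at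
   that scale, so Poincare's inequality in [Q] for the truncation of
   [(|u| - t) / d] to [[0, 1]] gives
     [r ^ (n - 1) <= c / d * int_(Q, t < |u| < t + d) |grad u|],
   while [mu (3 Q) <= c r ^ (n - 1) M_1 mu] everywhere on [Q]. A finite Vitali
   covering of [{|u| >= t + e}] by such cubes gives
     [mu {|u| >= t + e} <= c / d * int_(t < |u| < t + d) |grad u| M_1 mu].
   Letting [d], then [e], tend to 0, integrating over [t] (layer cake on the
   left, Fatou and Tonelli on the right) gives the theorem; this replaces the
   coarea formula. *)

From HB Require Import structures.
Require Import Defs.
From mathcomp Require Import all_boot all_order all_algebra.
From mathcomp Require Import all_classical all_reals all_analysis.
From mathcomp Require Import measurable_realfun ring lra.
Import Order.TTheory GRing.Theory Num.Theory.
Import numFieldTopology.Exports numFieldNormedType.Exports.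

Set Implicit Arguments.
Unset Strict Implicit.
Unset Printing Implicit Defensive.

Local Open Scope classical_set_scope.
Local Open Scope ring_scope.

(** * Lipschitz functions of one real variable *)

Section lipschitz_ftc.
Context {R : realType}.
Local Notation leb := (@lebesgue_measure R).

Lemma cumulative_of (f : R -> R) : nondecreasing f -> continuous f ->
  exists F : cumulative R R, F =1 f.
Proof.
move=> ndf cf.
by exists (HB.pack_for (cumulative R R) f
  (isCumulative.Build R _ R f ndf (right_continuousW cf))).
Qed.

(* By uniqueness the two Stieltjes measures add up to Lebesgue measure. *)
Lemma lebesgue_stieltjes_le (f1 f2 : cumulative R R) :
  (forall x, f1 x + f2 x = x) ->
  forall A, measurable A -> (lebesgue_stieltjes_measure f1 A <= leb A)%E.
Proof.
move=> f12 A mA.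
pose m1 := lebesgue_stieltjes_measure f1.
pose m2 := lebesgue_stieltjes_measure f2.
suff -> : leb A = measure_add m1 m2 A by rewrite measure_addE leeDl.
apply: lebesgue_measure_unique => //.
move=> _ [[a b] _ <-]; rewrite [RHS]measure_addE [in LHS]/= /=.
have E (f : cumulative R R) : lebesgue_stieltjes_measure f `]a, b]%classic =
    wlength f `]a, b]%classic.
  rewrite /lebesgue_stieltjes_measure /measure_extension measurable_mu_extE//.
  exact: is_ocitv.
rewrite /lebesgue_measure /m1 /m2 !E !wlength_itv /= lte_fin.
case: ifP => _; rewrite ?adde0//.
by rewrite -!EFinD; congr EFin; have := f12 a; have := f12 b; lra.
Qed.

(** Since [f1] and [f2] add up to the identity, the Stieltjes measure of [f1] is dominated by
    Lebesgue measure, hence absolutely continuous. Its Radon-Nikodym density on the bounded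
    interval, where it is finite, is the derivative of [f1] almost everywhere by Lebesgue
    differentiation. *)
Lemma nondecreasing_density (f1 f2 : cumulative R R) (a b : R) :
  (forall x, f1 x + f2 x = x) -> a < b ->
  exists phi : R -> R, [/\ measurable_fun setT phi,
    leb.-integrable setT (EFin \o phi),
    (\int[leb]_(x in `]a, b]) phi x)%R = f1 b - f1 a &
    {ae leb, forall x, x \in `]a, b[ -> derivable f1 x 1 /\ 'D_1 f1 x = phi x}].
Proof.
move=> f12 ab.
have wE c d : c <= d -> lebesgue_stieltjes_measure f1 `]c, d]%classic =
    (f1 d - f1 c)%:E.
  move=> cd; rewrite /lebesgue_stieltjes_measure /measure_extension.
  rewrite measurable_mu_extE; last exact: is_ocitv.
  exact: wlength_itv_bnd.
have mD : measurable (`]a, b]%classic : set (measurableTypeR R)) by exact: measurable_itv.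
have Doo : (lebesgue_stieltjes_measure f1 `]a, b]%classic < +oo)%E.
  by rewrite wE ?ltW// ltry.
have nuleb : mfrestr mD Doo `<< leb.
  move=> N N0 A mA AN; apply/eqP; rewrite eq_le measure_ge0 andbT.
  rewrite /mfrestr/= /mrestr -(N0 A mA AN).
  apply: (@le_trans _ _ (lebesgue_stieltjes_measure f1 A)).
    by rewrite le_measure ?inE//; apply: measurableI.
  exact: (lebesgue_stieltjes_le f12).
have [phi [phi0 phifin phiint phiE0]] := radon_nikodym_sigma_finite nuleb.
have phiE A : measurable A ->
    lebesgue_stieltjes_measure f1 (A `&` `]a, b]) = (\int[leb]_(x in A) phi x)%E.
  by move=> mA; rewrite -phiE0.
pose g x := fine (phi x).
have gE : EFin \o g = phi by apply/funext => x; rewrite /= fineK.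
have gint : leb.-integrable setT (EFin \o g) by rewrite gE.
have mg : measurable_fun setT g by apply/measurable_EFinP; exact: measurable_int gint.
(* The density belongs to the measure restricted to []a, b]], so the primitive from minus infinity
   only sees []a, x]]. *)
have FE x : x \in `[a, b] -> (\int[leb]_(t in `]-oo, x]) g t)%R = f1 x - f1 a.
  rewrite in_itv/= => /andP[ax xb].
  rewrite /Rintegral; under eq_integral do rewrite fineK//.
  rewrite -phiE; last exact: measurable_itv.
  rewrite (_ : _ `&` _ = `]a, x]%classic) ?wE//.
  apply/seteqP; split=> t /=; rewrite !in_itv/=; first by move=> [-> /andP[->]].
  by move=> /andP[at' tx]; rewrite tx at' (le_trans tx).
exists g; split => //.
  rewrite /Rintegral; under eq_integral do rewrite fineK//.
  by rewrite -phiE// setIid wE ?ltW.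
have lg := open_integrable_locally openT gint.
have gy y : leb.-integrable `]-oo, y] (EFin \o g).
  by apply: (integrableS measurableT) => //; exact: measurable_itv.
have := FTC1Ny gy lg.
apply: filterS; first exact: (ae_filter_ringOfSetsType leb).
move=> x [dF F'] xab.
have nF : \forall y \near x, (\int[leb]_(t in `]-oo, y]) g t)%R + f1 a = f1 y.
  have : \forall y \near x, y \in `]a, b[ by exact: near_in_itvoo.
  apply: filterS => y; rewrite in_itv/= => /andP[ay yb].
  by rewrite FE ?subrK// in_itv/= !ltW.
have dFc : is_derive x 1 ((fun y => (\int[leb]_(t in `]-oo, y]) g t)%R) \+ cst (f1 a)) (g x).
  rewrite -[g x]addr0; apply: is_deriveD; apply: DeriveDef => //.
  by rewrite -derive1E.
have [d1 d2] := near_eq_is_derive nF dFc.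
by split.
Qed.

(** The bound by [k] is asked only where [g] has a derivative; that this is almost everywhere is
    part of the proof, through [nondecreasing_density]. In this form the lemma applies on every
    coordinate line, with no exceptional set of lines. *)
Lemma lipschitz_ftc_le (g : R -> R) (L a b : R) (k : R -> R) :
  (forall x y, `|g x - g y| <= L * `|x - y|) -> a <= b ->
  measurable_fun setT k -> (forall x, 0 <= k x) ->
  (forall s, derivable g s 1 -> `|'D_1 g s| <= k s) ->
  ((`|g b - g a|)%:E <= \int[leb]_(s in `[a, b]) (k s)%:E)%E.
Proof.
move=> gL; rewrite le_eqVlt => /predU1P[<-|ab] mk k0 gk.
  by rewrite subrr normr0; apply: integral_ge0 => x _; rewrite lee_fin.
wlog L0 : L gL / 0 < L.
  move=> h; apply: (h (Num.max L 1)); last by rewrite lt_max ltr01 orbT.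
  move=> x y; apply: (le_trans (gL x y)); rewrite ler_wpM2r//.
  by rewrite le_max lexx.
have cg : continuous g.
  move=> x; apply/cvgrPdist_le => /= e e0; near=> y.
  apply: (le_trans (gL _ _)); rewrite -ler_pdivlMl//.
  by near: y; apply: cvgr_dist_le; [exact: cvg_id|rewrite mulr_gt0// invr_gt0].
(* [h 1] and [h (-1)] are nondecreasing with sum the identity, and [g] is an
   affine combination of [h 1] and the identity. *)
pose h (s : R) x := (x + s * (L^-1 * g x)) / 2.
have ch s : continuous (h s).
  move=> x; apply: cvgM; last exact: cvg_cst.
  apply: cvgD; first exact: cvg_id.
  apply: cvgM; first exact: cvg_cst.
  by apply: cvgM; [exact: cvg_cst|exact: cg].
have ndh s : `|s| <= 1 -> nondecreasing (h s).
  move=> s1 x y xy; rewrite /h ler_pM2r ?invr_gt0// -subr_ge0.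
  suff : `|s * (L^-1 * (g y - g x))| <= y - x.
    by rewrite ler_norml => /andP[+ _]; lra.
  rewrite normrM -[leRHS]mul1r ler_pM// normrM gtr0_norm ?invr_gt0//.
  by rewrite ler_pdivrMl// -[y - x]ger0_norm ?subr_ge0.
have [f1 f1E] := cumulative_of (ndh 1 ltac:(by rewrite normr1)) (ch 1).
have [f2 f2E] := cumulative_of (ndh (-1) ltac:(by rewrite normrN1)) (ch (-1)).
have f12 x : f1 x + f2 x = x by rewrite f1E f2E /h; lra.
have [phi [mphi phii phiI aphi]] := nondecreasing_density f12 ab.
have gE x : g x = L * (2 * f1 x - x) by rewrite f1E /h; field; rewrite gt_eqF.
pose psi x := L * (2 * phi x - 1).
have ifin (A := `]a, b]%classic) : leb.-integrable A (EFin \o phi).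
  by apply: (integrableS measurableT) => //; exact: measurable_itv.
have i1 : leb.-integrable `]a, b]%classic (EFin \o (cst 1 : R -> R)).
  apply/integrableP; split; first exact/measurable_EFinP.
  rewrite (_ : (fun x => _) = cst 1%E); last by apply/funext => x /=; rewrite normr1.
  by rewrite integral_cst//= mul1e lebesgue_measure_itv/=; case: ifP => _; rewrite ltry.
have ipsi : leb.-integrable `]a, b]%classic (EFin \o psi).
  rewrite (_ : EFin \o psi = (fun x => L%:E * ((2%:E * (EFin \o phi) x) -
    (EFin \o (cst 1%R : R -> R)) x))%E); last exact/funext.
  apply: integrableZl => //; apply: integrableB => //.
  exact: integrableZl.
have mpsi : measurable_fun setT psi.
  apply: measurable_funM => //; apply: measurable_funB => //.
  exact: measurable_funM.
have gba : g b - g a = (\int[leb]_(x in `]a, b]) psi x)%R.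
  rewrite (_ : psi = (fun x => L * ((2 * phi x) - (cst 1 : R -> R) x))) //.
  have i2 : leb.-integrable `]a, b]%classic (EFin \o (fun x => 2 * phi x)).
    by rewrite (_ : EFin \o _ = (fun x => 2%:E * (EFin \o phi) x)%E)//; apply: integrableZl.
  rewrite RintegralZl//; last exact: (integrableB _ i2 i1).
  rewrite RintegralB// RintegralZl// phiI Rintegral_cst// !gE.
  by rewrite /= lebesgue_measure_itv/= lte_fin ab /=; ring.
rewrite gba.
apply: (@le_trans _ _ (\int[leb]_(x in `]a, b]) (`|psi x|)%:E)%E).
  rewrite EFin_normr_Rintegral//.
  by apply: le_trans (le_abse_integral _ _ _) _ => //; exact: measurable_int ipsi.
(* The derivative is identified with [psi] only inside the open interval, so the null endpoint [b]
   is dropped. *)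
rewrite -integral_itv_bndo_bndc; last first.
  by apply/measurable_EFinP; apply: measurable_funTS; exact: measurableT_comp.
apply: (@le_trans _ _ (\int[leb]_(x in `]a, b[) (k x)%:E)%E).
  apply: ae_ge0_le_integral => //.
  - by apply/measurable_EFinP; apply: measurable_funTS; exact: measurableT_comp.
  - by move=> x _; rewrite lee_fin.
  - by apply/measurable_EFinP; exact: measurable_funTS.
  - move: aphi; apply: filterS; first exact: (ae_filter_ringOfSetsType leb).
    move=> x + xab => /(_ xab)[d1 d2].
    have dg : is_derive x 1 g (psi x).
      rewrite (_ : g = (L \*: ((2 \*: (f1 : R -> R)) - id))); last exact/funext.
      rewrite /psi -d2; apply: is_deriveZ; apply: is_deriveB.
      by apply: is_deriveZ; apply: DeriveDef.
    by rewrite lee_fin -(@derive_val _ _ _ _ _ _ _ dg); apply: gk; apply: ex_derive.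
apply: ge0_subset_integral => //.
- by apply/measurable_EFinP; exact: measurable_funTS.
- by move=> x _; rewrite lee_fin.
- exact: subset_itv_oo_cc.
Unshelve. all: by end_near. Qed.
End lipschitz_ftc.

(** * Poincare's inequality on boxes *)

Section tonelli_on.
Local Open Scope ereal_scope.
Context d1 d2 (T1 : measurableType d1) (T2 : measurableType d2) (R : realType).
Variable m1 : {sigma_finite_measure set T1 -> \bar R}.
Variable m2 : {sigma_finite_measure set T2 -> \bar R}.
Variables (D1 : set T1) (D2 : set T2) (f : T1 * T2 -> \bar R).
Hypotheses (mD1 : measurable D1) (mD2 : measurable D2).
Hypotheses (mf : measurable_fun setT f) (f0 : forall z, 0 <= f z).

(** Extension by 0, which is the [point] of the extended reals, reduces integrals over the rectangle
    to Tonelli's theorem on the whole product. *)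
Let g := f \_ (D1 `*` D2).

Let mg : measurable_fun setT g.
Proof.
exact/(measurable_restrictT _ (measurableX mD1 mD2))/measurable_funTS.
Qed.

Let g0 z : 0 <= g z. Proof. by apply: erestrict_ge0. Qed.

Let gE x y :
  g (x, y) = if x \in D1 then if y \in D2 then f (x, y) else point else point.
Proof. by rewrite /g patchE in_setX; case: (x \in D1). Qed.

Lemma tonelli_on1 :
  \int[m1 \x m2]_(z in D1 `*` D2) f z = \int[m1]_(x in D1) \int[m2]_(y in D2) f (x, y).
Proof.
rewrite integral_mkcond fubini_tonelli1// [RHS]integral_mkcond.
apply: eq_integral => x _; rewrite patchE /fubini_F -/g.
under eq_integral do rewrite gE.
by case: ifPn => _; [rewrite [RHS]integral_mkcond|rewrite integral0].
Qed.

Lemma tonelli_on2 :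
  \int[m1 \x m2]_(z in D1 `*` D2) f z = \int[m2]_(y in D2) \int[m1]_(x in D1) f (x, y).
Proof.
rewrite integral_mkcond fubini_tonelli2// [RHS]integral_mkcond.
apply: eq_integral => y _; rewrite patchE /fubini_G -/g.
under eq_integral do rewrite gE.
case: ifPn => _; first by rewrite [RHS]integral_mkcond.
by under eq_integral do rewrite if_same; rewrite integral0.
Qed.

Lemma tonelli_on :
  \int[m1]_(x in D1) \int[m2]_(y in D2) f (x, y) =
  \int[m2]_(y in D2) \int[m1]_(x in D1) f (x, y).
Proof. by rewrite -tonelli_on1 tonelli_on2. Qed.

Lemma measurable_tonelli_on : measurable_fun setT (fun x => \int[m2]_(y in D2) f (x, y)).
Proof.
pose h := f \_ ([set: T1] `*` D2).
have mh : measurable_fun setT h.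
  exact/(measurable_restrictT _ (measurableX (@measurableT _ T1) mD2))/measurable_funTS.
rewrite (_ : (fun x => _) = fubini_F m2 h); last first.
  apply/funext => x; rewrite /fubini_F [LHS]integral_mkcond.
  by apply: eq_integral => y _; rewrite /h !patchE in_setX/= in_setT.
by apply: measurable_fun_fubini_tonelli_F => //; apply: erestrict_ge0.
Qed.

Lemma measurable_tonelli_on2 : measurable_fun setT (fun y => \int[m1]_(x in D1) f (x, y)).
Proof.
pose h := f \_ (D1 `*` [set: T2]).
have mh : measurable_fun setT h.
  exact/(measurable_restrictT _ (measurableX mD1 (@measurableT _ T2)))/measurable_funTS.
rewrite (_ : (fun x => _) = fubini_G m1 h); last first.
  apply/funext => y; rewrite /fubini_G [LHS]integral_mkcond.
  by apply: eq_integral => x _; rewrite /h !patchE in_setX/= in_setT andbT.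
by apply: measurable_fun_fubini_tonelli_G => //; apply: erestrict_ge0.
Qed.

End tonelli_on.

(** Otherwise [f] exceeds its average at every point of [D]; the difference is then positive on [D]
    with integral 0, which forces [D] to be null. *)
Lemma exists_le_average d (T : measurableType d) (R : realType)
    (m : {measure set T -> \bar R}) (D : set T) (l : R) (f : T -> \bar R) :
  measurable D -> 0 < l -> m D = l%:E -> measurable_fun D f ->
  (forall x, D x -> 0 <= f x)%E ->
  exists2 x, D x & (l%:E * f x <= \int[m]_(x in D) f x)%E.
Proof.
move=> mD l0 mDl mf f0; apply/not_exists2P => /= lt_f.
have {}lt_f x : D x -> (\int[m]_(x in D) f x < l%:E * f x)%E.
  by move=> Dx; have [//|/negP] := lt_f x; rewrite -ltNge.
(* Lying strictly below [l%:E * f x] at a single point makes the integral finite. *)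
have [K KE] : exists K : R, (\int[m]_(x in D) f x = K%:E)%E.
  have I0 : (0 <= \int[m]_(x in D) f x)%E by exact: integral_ge0.
  have [x Dx] : D !=set0.
    by apply/set0P/negP => /eqP D0; move: mDl l0; rewrite D0 measure0 => -[<-]; rewrite ltxx.
  exists (fine (\int[m]_(x in D) f x)%E); rewrite fineK// ge0_fin_numE//.
  by apply: (lt_le_trans (lt_f _ Dx)); rewrite leey.
have ltK x : D x -> ((K / l)%:E < f x)%E.
  by move=> /lt_f; rewrite KE mulrC EFinM lte_pdivrMl.
have K0 : 0 <= K by rewrite -lee_fin -KE; apply: integral_ge0.
pose g x := (f x - (K / l)%:E)%E.
have mg : measurable_fun D g by apply: emeasurable_funB.
have g0 x : D x -> (0 <= g x)%E by move=> /ltK/ltW; rewrite sube_ge0.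
have : (\int[m]_(x in D) f x = \int[m]_(x in D) g x + (K / l)%:E * m D)%E.
  rewrite -integral_cst// -ge0_integralD//; last by move=> x _; rewrite lee_fin divr_ge0// ltW.
  by apply: eq_integral => x _; rewrite /g subeK.
rewrite KE mDl -EFinM divfK ?gt_eqF// => /esym Kg.
have g00 : (\int[m]_(x in D) g x = 0)%E.
  by move: Kg; case: (\int[m]_(x in D) g x)%E => //= r [] rK; congr EFin; lra.
have : ae_eq m D g (cst 0%E).
  apply/(@ae_eq_integral_abs _ _ _ m D mD g mg); rewrite -[RHS]g00.
  by apply: eq_integral => x /[!inE] Dx; rewrite gee0_abs// g0.
have nD : (m D != 0)%E by rewrite mDl eqe gt_eqF.
move=> [N [mN N0 DN]]; move/eqP: nD; apply.
apply/eqP; rewrite -measure_le0 -N0 le_measure ?inE// => x Dx.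
by apply: DN => /(_ Dx) gx0; have := ltK _ Dx; rewrite -sube_gt0 -/(g x) gx0 ltxx.
Qed.

Section box.
Context {R : realType}.
Local Notation leb := (@lebesgue_measure R).
Local Notation mR := (measurableTypeR R).

Definition box n (A : 'I_n -> set mR) : set 'rV[R]_n :=
  [set v | forall i, A i (v 0 i)].

Definition upd n (x : 'rV[R]_n) (i : 'I_n) (s : R) : 'rV[R]_n :=
  \row_j if j == i then s else x 0 j.

Lemma upd_cons0 n s (y : 'rV[R]_n) t : upd (cons_rV (s, y)) ord0 t = cons_rV (t, y).
Proof.
apply/rowP => j; rewrite mxE; case: (unliftP ord0 j) => [j' ->|->].
  by rewrite eq_sym (negbTE (neq_lift _ _)) !cons_rVS.
by rewrite eqxx cons_rV0.
Qed.

Lemma upd_consS n s (y : 'rV[R]_n) i t :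
  upd (cons_rV (s, y)) (lift ord0 i) t = cons_rV (s, upd y i t).
Proof.
apply/rowP => j; rewrite mxE; case: (unliftP ord0 j) => [j' ->|->].
  by rewrite !cons_rVS /= mxE (inj_eq lift_inj).
by rewrite !cons_rV0 (negbTE (neq_lift _ _)).
Qed.

Lemma measurable_cons_rVr n s :
  measurable_fun setT (fun y : 'rV[R]_n => cons_rV ((s : mR), y)).
Proof.
apply: (measurableT_comp (@measurable_cons_rV R n)); exact: pair1_measurable.
Qed.

Section integral_box.
Local Open Scope ereal_scope.
Variables (n : nat) (A : 'I_n.+1 -> set mR) (f : 'rV[R]_n.+1 -> \bar R).
Hypotheses (mA : forall i, measurable (A i)).
Hypotheses (mf : measurable_fun setT f) (f0 : forall x, 0 <= f x).
Let A0 : set mR := A ord0.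
Let A' i : set mR := A (lift ord0 i).

Lemma integral_box_prod :
  \int[lebesgue_rV]_(x in box A) f x =
  \int[leb \x @lebesgue_rV R n]_(p in A0 `*` box A') f (cons_rV p).
Proof.
rewrite -preimage_cons_rV_box.
(* In dimension [n.+1], [lebesgue_rV] is this pushforward by definition. *)
transitivity (\int[pushforward (leb \x @lebesgue_rV R n) (@cons_rV R n)]_(x in box A) f x).
  by [].
rewrite ge0_integral_pushforward//.
- exact: measurable_cons_rV.
- exact: measurable_box_rV.
- exact: measurable_funTS.
Qed.

Let mfc : measurable_fun setT (f \o @cons_rV R n).
Proof. by apply: measurableT_comp => //; exact: measurable_cons_rV. Qed.

Let mA' : measurable (box A').
Proof. by apply: (@measurable_box_rV R n A') => i; exact: mA. Qed.

Lemma integral_box :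
  \int[lebesgue_rV]_(x in box A) f x =
  \int[leb]_(s in A0) \int[lebesgue_rV]_(y in box A') f (cons_rV (s, y)).
Proof.
rewrite integral_box_prod.
exact: (tonelli_on1 _ _ (mA _) mA' mfc (fun p => f0 _)).
Qed.

Lemma integral_box_swap :
  \int[lebesgue_rV]_(x in box A) f x =
  \int[lebesgue_rV]_(y in box A') \int[leb]_(s in A0) f (cons_rV (s, y)).
Proof.
rewrite integral_box_prod.
exact: (tonelli_on2 _ _ (mA _) mA' mfc (fun p => f0 _)).
Qed.

Lemma measurable_integral_box2 : measurable_fun setT
  (fun y : 'rV[R]_n => \int[leb]_(s in A0) f (cons_rV (s, y))).
Proof.
exact: (measurable_tonelli_on2 _ (mA _) mfc (fun p => f0 _)).
Qed.

Lemma measurable_integral_box : measurable_fun setT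
  (fun s : mR => \int[lebesgue_rV]_(y in box A') f (cons_rV (s, y))).
Proof.
exact: (measurable_tonelli_on _ mA' mfc (fun p => f0 _)).
Qed.

End integral_box.

(** Derivatives enter only through bounds [h i] on the oscillation of [w] along coordinate lines.
    Slices of the box inherit such bounds, so induction on the dimension applies, and the factor
    stays equal to the side [l] at each step. *)
Lemma poincare_box n (l : R) (A : 'I_n -> set mR) (w : 'rV[R]_n -> R)
    (h : 'I_n -> 'rV[R]_n -> \bar R) :
  0 < l -> (forall i, measurable (A i)) -> (forall i, leb (A i) = l%:E) ->
  measurable_fun setT w -> (forall i, measurable_fun setT (h i)) ->
  (forall i x, (0 <= h i x)%E) ->
  (forall i x a b, A i a -> A i b ->
    (`|w (upd x i a) - w (upd x i b)|%:E <= \int[leb]_(s in A i) h i (upd x i s))%E) ->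
  exists c, (\int[lebesgue_rV]_(x in box A) `|w x - c|%:E <=
    l%:E * \int[lebesgue_rV]_(x in box A) \sum_(i < n) h i x)%E.
Proof.
move=> l0; elim: n A w h => [|n IHn] A w h mA lA mw mh h0 wh.
  exists (w 0); rewrite (eq_integral (cst 0%E)) => [|x _]; last first.
    by rewrite (_ : x = 0) ?subrr ?normr0//; apply/rowP => -[].
  rewrite integral0; apply: mule_ge0; first by rewrite lee_fin ltW.
  apply: integral_ge0 => x _.
  by rewrite big_ord0.
pose A' i := A (lift ord0 i).
have mA' : measurable (box A').
  by apply: (@measurable_box_rV R n A') => i; exact: mA.
have mA0 : measurable (A ord0 : set mR) by [].
pose H (x : 'rV[R]_n.+1) : \bar R := (\sum_(i < n) h (lift ord0 i) x)%E.
have mH : measurable_fun setT H by exact: emeasurable_sum.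
have H0 x : (0 <= H x)%E by exact: sume_ge0.
pose phi s := (\int[lebesgue_rV]_(y in box A') H (cons_rV (s, y)))%E.
have phi0 s : (0 <= phi s)%E by exact: integral_ge0.
have mphi : measurable_fun setT (phi : mR -> _) by exact: measurable_integral_box.
(* The constant comes, by induction, from a slice [s0] whose energy is at most
   the average; the other slices are compared with it along the first axis. *)
have [s0 As0 phis0] :=
  exists_le_average mA0 l0 (lA _) (measurable_funTS mphi) (fun x _ => phi0 x).
set K := (\int[leb]_(s in A ord0) phi s)%E in phis0.
have KE : K = (\int[lebesgue_rV]_(x in box A) H x)%E by rewrite integral_box.
have mc s := @measurable_cons_rVr n s.
have wh' i y a b : A' i a -> A' i b ->
    (`|w (cons_rV (s0, upd y i a)) - w (cons_rV (s0, upd y i b))|%:E <=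
     \int[leb]_(s in A' i) h (lift ord0 i) (cons_rV (s0, upd y i s)))%E.
  move=> Aa Ab; rewrite -!upd_consS.
  by under eq_integral do rewrite -upd_consS; exact: wh.
have [c cP] := IHn A' (fun y => w (cons_rV (s0, y)))
  (fun i y => h (lift ord0 i) (cons_rV (s0, y))) (fun i => mA _) (fun i => lA _)
  (measurableT_comp mw (mc s0)) (fun i => measurableT_comp (mh _) (mc s0))
  (fun i y => h0 _ _) wh'.
exists c.
have {phis0}cK : (\int[lebesgue_rV]_(y in box A') `|w (cons_rV (s0, y)) - c|%:E <= K)%E.
  exact: le_trans cP phis0.
have mwc : measurable_fun setT (fun x => `|w x - c|%:E).
  by apply/measurable_EFinP; apply: measurableT_comp => //; exact: measurable_funB.
have wc0 x : (0 <= `|w x - c|%:E)%E by rewrite lee_fin.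
rewrite integral_box//.
pose J := (\int[lebesgue_rV]_(x in box A) h ord0 x)%E.
have JE : J = (\int[lebesgue_rV]_(y in box A')
    \int[leb]_(t in A ord0) h ord0 (cons_rV (t, y)))%E.
  by rewrite /J integral_box_swap.
have mJ : measurable_fun setT (fun y => \int[leb]_(t in A ord0) h ord0 (cons_rV (t, y)))%E.
  exact: measurable_integral_box2.
have slice s : A ord0 s ->
    (\int[lebesgue_rV]_(y in box A') `|w (cons_rV (s, y)) - c|%:E <= J + K)%E.
  move=> As; apply: (@le_trans _ _ (J +
    \int[lebesgue_rV]_(y in box A') `|w (cons_rV (s0, y)) - c|%:E)%E); last first.
    by rewrite leeD2l.
  have m0 t : measurable_fun (box A') (fun y => `|w (cons_rV (t, y)) - c|%:E).
    by apply: measurable_funTS; exact: (measurableT_comp mwc (mc t)).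
  have J0 y : (0 <= \int[leb]_(t in A ord0) h ord0 (cons_rV (t, y)))%E.
    exact: integral_ge0.
  rewrite JE -ge0_integralD//; last exact: measurable_funTS.
  apply: ge0_le_integral => //.
  - by apply: emeasurable_funD => //; exact: measurable_funTS.
  move=> y _; have := wh ord0 (cons_rV (s, y)) s s0 As As0.
  rewrite !upd_cons0; under eq_integral do rewrite upd_cons0.
  move=> /(leeD2r `|w (cons_rV (s0, y)) - c|%:E); apply: le_trans.
  by rewrite -EFinD lee_fin ler_distD.
apply: (@le_trans _ _ (\int[leb]_(s in A ord0) (cst (J + K) s))%E).
  apply: ge0_le_integral => //.
  - by move=> s _; apply: integral_ge0 => y _; rewrite lee_fin.
  - apply: measurable_funTS; exact: (measurable_integral_box mA mwc wc0).
have -> : (\int[leb]_(s in A ord0) (cst (J + K) s) = l%:E * (J + K))%E.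
  by rewrite integral_cst// muleC; congr (_ * _)%E; exact: lA.
apply: lee_wpmul2l; first by rewrite lee_fin ltW.
have mbA : measurable (box A) by exact: measurable_box_rV.
rewrite KE -ge0_integralD//; [|exact: measurable_funTS|exact: measurable_funTS].
by under [leRHS]eq_integral do rewrite big_ord_recl.
Qed.
End box.

(** * Partial derivatives and truncation *)

(* Unification unfolds [nbhs x] too far for the library instance to be found. *)
#[local] Instance nbhs_rV_filter (R : realType) n (x : 'rV[R]_n) :
  ProperFilter (nbhs x) := nbhs_pfilter x.

Section partial_derivatives.
Context {R : realType} {n : nat}.
Implicit Types (f w u : 'rV[R]_n -> R) (i : 'I_n) (x : 'rV[R]_n).

Definition basis i : 'rV[R]_n := delta_mx 0 i.

(* Unlike ['D_v f x], which is arbitrary where [f] has no derivative, this is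
   measurable for continuous [f]. *)
Definition abs_partial f i x : R :=
  if `[< derivable f x (basis i) >] then `|'D_(basis i) f x| else 0.

Lemma abs_partial_ge0 f i x : 0 <= abs_partial f i x.
Proof. by rewrite /abs_partial; case: ifP. Qed.

Lemma abs_partial_le_grad f i x : abs_partial f i x <= eucl_norm (grad f x).
Proof.
apply: (@le_trans _ _ `|'D_(basis i) f x|); first by rewrite /abs_partial; case: ifP.
rewrite -sqrtr_sqr ler_wsqrtr// (bigD1 i)//= mxE lerDl.
by apply: sumr_ge0 => j _; exact: sqr_ge0.
Qed.

Definition diffquot f i (h : R) x : R := h^-1 * (f (h *: basis i + x) - f x).

Lemma continuous_diffquot f i h : continuous f -> continuous (diffquot f i h).
Proof.
move=> cf x.
have c1 : (fun y => h *: basis i + y) @ x --> h *: basis i + x.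
  apply: cvgD; [exact: cvg_cst|exact: cvg_id].
have c2 : (fun y => f (h *: basis i + y)) @ x --> f (h *: basis i + x).
  exact: (cvg_comp _ _ c1 (cf _)).
have c3 : (fun=> h^-1) @ x --> h^-1 by exact: cvg_cst.
exact: (cvgM c3 (cvgB c2 (cf _))).
Qed.

Lemma measurable_continuous_rV f : continuous f -> measurable_fun setT f.
Proof.
move=> cf; apply: (@measurability _ _ _ _ _ _ (@RGenOpens.G R)).
  exact: RGenOpens.measurableE.
move=> _ [_ [a [b ->]] <-]; rewrite setTI.
apply: open_measurable_mx; apply: open_comp; last exact: interval_open.
by move=> v _; exact: cf.
Qed.

Lemma measurable_norm_continuous u : continuous u -> measurable_fun setT (fun y => `|u y|).
Proof.
by move=> cu; apply: measurableT_comp => //; exact: measurable_continuous_rV.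
Qed.

Lemma closed_measurable_rV (A : set 'rV[R]_n) : closed A -> measurable A.
Proof.
move=> cA; rewrite -(setCK A); apply: measurableC; apply: open_measurable_mx.
exact: closed_openC.
Qed.

(** Cauchy's criterion for the difference quotients, written with sets that are closed when [f] is
    continuous: an intersection over pairs of steps of closed conditions. This makes the set of
    derivability measurable. *)
Let C f i (k m : nat) : set 'rV[R]_n :=
  \bigcap_(h in [set h : R * R | [/\ h.1 != 0, h.2 != 0,
      `|h.1| <= m.+1%:R^-1 & `|h.2| <= m.+1%:R^-1]])
    [set x | `|diffquot f i h.1 x - diffquot f i h.2 x| <= k.+1%:R^-1].

Let derivableE f i :
  [set x | derivable f x (basis i)] = \bigcap_k \bigcup_m C f i k m.
Proof.
apply/seteqP; split=> x /=.
  move=> /cvg_ex[l /cvgrPdist_le fl] k _ /=.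
  have k0 : (0 : R) < k.+1%:R^-1 / 2 by rewrite divr_gt0// invr_gt0.
  have [e /= e0 fe] := fl _ k0.
  have [m _ /(_ m (leqnn _)) me] := near_infty_natSinv_lt (PosNum e0).
  exists m => // -[h1 h2] /= [h10 h20 h1m h2m].
  have H h : h != 0 -> `|h| <= m.+1%:R^-1 -> `|l - diffquot f i h x| <= k.+1%:R^-1 / 2.
    move=> h0 hm; apply: fe => //=.
    by rewrite sub0r normrN (le_lt_trans hm).
  rewrite (splitr k.+1%:R^-1) (le_trans (ler_distD l _ _))// lerD ?H//.
  by rewrite distrC H.
move=> xC; apply/cauchy_cvgP/cauchy_exP => e e0.
have [k _ /(_ k (leqnn _)) ke] := near_infty_natSinv_lt (PosNum e0).
have [m _ Cm] := xC k I.
have m0 : (0 : R) < m.+1%:R^-1 by rewrite invr_gt0.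
exists (diffquot f i m.+1%:R^-1 x).
suff : \forall h \near (0 : R)^', ball (diffquot f i m.+1%:R^-1 x) e (diffquot f i h x) by [].
near=> h; rewrite /ball/=; apply: le_lt_trans ke.
apply: (Cm (m.+1%:R^-1, h)); split => /=.
- by rewrite gt_eqF.
- by near: h; exact: nbhs_dnbhs_neq.
- by rewrite gtr0_norm.
- by near: h; apply: dnbhs0_le.
Unshelve. all: by end_near. Qed.

Lemma measurable_derivable f i : continuous f ->
  measurable [set x | derivable f x (basis i)].
Proof.
move=> cf; rewrite derivableE; apply: bigcapT_measurable => k.
apply: bigcupT_measurable => m; apply: closed_measurable_rV.
apply: closed_bigI => h _.
apply: (@closed_comp _ _ (fun x => `|diffquot f i h.1 x - diffquot f i h.2 x|)
  [set y | y <= k.+1%:R^-1]); last exact: closed_le.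
move=> x _; apply: cvg_norm; apply: cvgB; exact: continuous_diffquot.
Qed.

(** On the measurable set of derivability it is the limit of the continuous quotients with steps
    [k.+1%:R^-1]; elsewhere it is 0. *)
Lemma measurable_abs_partial f i : continuous f ->
  measurable_fun setT (abs_partial f i).
Proof.
move=> cf; pose D := [set x | derivable f x (basis i)].
have mD : measurable D by exact: measurable_derivable.
pose q k x := `|diffquot f i k.+1%:R^-1 x|.
have mq k : measurable_fun setT (q k).
  apply: measurableT_comp => //; apply: measurable_continuous_rV.
  exact: continuous_diffquot.
rewrite (_ : abs_partial f i = (fun x => `|'D_(basis i) f x|) \_ D); last first.
  apply/funext => x; rewrite /abs_partial patchE.
  by case: asboolP => xD; [rewrite mem_set|rewrite memNset].
apply/(measurable_restrictT _ mD).
apply: (@measurable_fun_cvg _ _ _ D q) => [k|x Dx].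
  exact: measurable_funTS.
apply: cvg_norm.
have := Dx; rewrite /D/= /derivable => /cvg_ex[l fl].
rewrite /derive (cvg_lim _ fl)//.
have k0 : (fun k : nat => (k.+1%:R^-1 : R)) @ \oo --> (0 : R)^'.
  move=> P [e /= e0 eP]; have := near_infty_natSinv_lt (PosNum e0).
  apply: filterS => k /= ke; apply: eP => /=; last by rewrite gt_eqF// invr_gt0.
  by rewrite sub0r normrN gtr0_norm// invr_gt0.
exact: (cvg_comp _ _ k0 fl).
Qed.


(** At a maximum the quotients from the right are nonpositive; those from the left, used next, are
    nonnegative. *)
Let derive_at_max_le0 f x v : derivable f x v -> (forall y, f y <= f x) -> 'D_v f x <= 0.
Proof.
move=> df fx; rewrite ['D_v f x]cvg_at_rightE; last exact: df.
apply: limr_le.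
  rewrite -(cvg_at_rightE (fun h : R => h^-1 *: ((f \o shift x) (h *: v) - f x))) //.
  apply: cvg_trans df; apply: cvg_app.
  move=> A [e egt0 Ae]; exists e => // y xe xgt0; apply: Ae => //.
  exact/lt0r_neq0.
near=> h; apply: mulr_ge0_le0.
  by rewrite invr_ge0; apply: ltW; near: h; exists 1 => /=.
by rewrite subr_le0; exact: fx.
Unshelve. all: by end_near. Qed.

Let derive_at_max_ge0 f x v : derivable f x v -> (forall y, f y <= f x) -> 0 <= 'D_v f x.
Proof.
move=> df fx; rewrite ['D_v f x]cvg_at_leftE; last exact: df.
apply: limr_ge.
  rewrite -(cvg_at_leftE (fun h : R => h^-1 *: ((f \o shift x) (h *: v) - f x))) //.
  apply: cvg_trans df; apply: cvg_app.
  move=> A [e egt0 Ae]; exists e => // y xe xgt0; apply: Ae => //.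
  exact/ltr0_neq0.
near=> h; apply: mulr_le0.
  by rewrite invr_le0; apply: ltW; near: h; exists 1 => /=.
by rewrite subr_le0; exact: fx.
Unshelve. all: by end_near. Qed.

Lemma derive_at_max f x v : derivable f x v -> (forall y, f y <= f x) -> 'D_v f x = 0.
Proof.
by move=> df fx; apply/eqP; rewrite eq_le derive_at_max_le0// derive_at_max_ge0.
Qed.

Lemma derive_at_min f x v : derivable f x v -> (forall y, f x <= f y) -> 'D_v f x = 0.
Proof.
move=> df fx; apply/eqP; rewrite -oppr_eq0 -deriveN//; apply/eqP.
by apply: derive_at_max; [exact: derivableN|move=> y; rewrite lerN2].
Qed.

Definition clip (t d s : R) : R := Num.min 1 (Num.max 0 ((s - t) / d)).

(** Outside the open layer the truncation is at its minimum 0 or its maximum 1, so a derivative that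
    exists there vanishes, even at points with [|u x|] equal to [t] or [t + d]. Inside the layer [u]
    is locally an affine function of the truncation, with the sign of [u x] as a factor, so [u] is
    derivable as well. *)
Lemma derive_clip_le u t d i x : continuous u -> 0 <= t -> 0 < d ->
  derivable (fun y => clip t d `|u y|) x (basis i) ->
  `|'D_(basis i) (fun y => clip t d `|u y|) x| <=
    d^-1 * (if t < `|u x| < t + d then abs_partial u i x else 0).
Proof.
move=> cu t0 d0; set w := fun y => _ => dw.
have [utd|] := boolP (t < `|u x| < t + d); last first.
  rewrite mulr0 negb_and -!leNgt => utd.
  suff -> : 'D_(basis i) w x = 0 by rewrite normr0.
  have w01 y : 0 <= w y <= 1.
    by rewrite /w /clip le_min ler01 le_max lexx ge_min lexx.
  case/orP: utd => utd.
    apply: derive_at_min => // y.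
    have -> : w x = 0.
      rewrite /w /clip max_l ?min_r// pmulr_lle0 ?invr_gt0// subr_le0//.
    by have /andP[] := w01 y.
  apply: derive_at_max => // y.
  have -> : w x = 1.
    have ? : 1 <= (`|u x| - t) / d by rewrite ler_pdivlMr// mul1r lerBrDl.
    by rewrite /w /clip max_r ?min_l// (le_trans ler01).
  by have /andP[] := w01 y.
pose s := Num.sg (u x).
have /andP[tu utd2] := utd.
have ux0 : u x != 0 by rewrite -normr_gt0 (le_lt_trans t0).
have nu : \forall y \near x, s * (d * w y + t) = u y.
  have su0 : 0 < s * u x by rewrite /s -normrEsg normr_gt0.
  have csu : {for x, continuous (fun y => s * u y)}.
    have c3 : (fun=> s) @ x --> s by exact: cvg_cst.
    exact: (cvgM c3 (cu _)).
  have cnu : {for x, continuous (fun y => `|u y|)} by apply: cvg_norm; exact: cu.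
  near=> y.
  have suy : 0 < s * u y by near: y; exact: (cvgr_gt _ csu).
  have tuy : t < `|u y| by near: y; exact: (cvgr_gt _ cnu).
  have uyd : `|u y| < t + d by near: y; exact: (cvgr_lt _ cnu).
  have s1 : s * s = 1 by rewrite -expr2 sqr_sg ux0.
  have uyE : `|u y| = s * u y.
    by rewrite -(gtr0_norm suy) normrM /s normr_sg ux0 mul1r.
  rewrite /w /clip max_r ?divr_ge0 ?subr_ge0 ?ltW// min_r; last first.
    by rewrite ler_pdivrMr// mul1r lerBlDl ltW.
  by rewrite [d * _]mulrC divfK ?gt_eqF// subrK uyE mulrA s1 mul1r.
have dwu : is_derive x (basis i) (fun y => s * (d * w y + t)) (s * (d * 'D_(basis i) w x)).
  rewrite (_ : (fun y => _) = s \*: ((d \*: w) + cst t)); last exact/funext.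
  have dw1 : is_derive x (basis i) w ('D_(basis i) w x) by exact: DeriveDef.
  rewrite -[X in s * X]addr0; by apply: is_deriveZ; apply: is_deriveD.
have [d1 d2] := near_eq_is_derive nu dwu.
rewrite /abs_partial asboolT// d2 !normrM normr_sg ux0 mul1r gtr0_norm//.
by rewrite mulKf// gt_eqF.
Unshelve. all: by end_near. Qed.

Lemma upd_shift x i s h : upd x i (h + s) = h *: basis i + upd x i s.
Proof.
by apply/rowP => j; rewrite !mxE eqxx/=; case: eqP; rewrite ?mulr1 ?mulr0 ?add0r.
Qed.

Let diffquot_upd w x i s :
  (fun h => h^-1 *: (((fun s => w (upd x i s)) \o shift s) (h *: 1) - w (upd x i s))) =
  (fun h => h^-1 *: ((w \o shift (upd x i s)) (h *: basis i) - w (upd x i s))).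
Proof. by apply/funext => h /=; rewrite [h%:A]mulr1 upd_shift. Qed.

Lemma derivable_upd w x i s : derivable (fun s => w (upd x i s)) s 1 =
  derivable w (upd x i s) (basis i).
Proof. by rewrite /derivable diffquot_upd. Qed.

Lemma derive_upd w x i s :
  'D_1 (fun s => w (upd x i s)) s = 'D_(basis i) w (upd x i s).
Proof. by rewrite /derive diffquot_upd. Qed.

Lemma ler_coord_eucl x i : `|x 0 i| <= eucl_norm x.
Proof.
rewrite -sqrtr_sqr ler_wsqrtr// (bigD1 i)//= lerDl.
by apply: sumr_ge0 => j _; exact: sqr_ge0.
Qed.

Lemma eucl_norm_ge0 x : 0 <= eucl_norm x. Proof. exact: sqrtr_ge0. Qed.

Lemma ler_coord_norm x i : `|x 0 i| <= `|x|.
Proof.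
rewrite [leRHS]mx_normrE.
exact: (le_bigmax _ (fun ij : 'I_1 * 'I_n => `|x ij.1 ij.2|) (ord0, i)).
Qed.

Lemma eucl_norm_le x : eucl_norm x <= n%:R * `|x|.
Proof.
rewrite -(ler_pXn2r (ltn0Sn 1)) ?nnegrE ?eucl_norm_ge0 ?mulr_ge0//.
rewrite sqr_sqrtr; last by apply: sumr_ge0 => j _; exact: sqr_ge0.
apply: (@le_trans _ _ (n%:R * `|x| ^+ 2)).
  rewrite -[n in n%:R]card_ord -sumr_const mulr_suml; apply: ler_sum => i _.
  by rewrite mul1r -[leLHS]real_normK ?num_real// lerXn2r ?nnegrE ?ler_coord_norm.
rewrite exprMn ler_wpM2r ?sqr_ge0// -natrX ler_nat.
by case: (n) => // m; rewrite expnS leq_pmulr.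
Qed.

Lemma eucl_norm_upd x i a b : eucl_norm (upd x i a - upd x i b) = `|a - b|.
Proof.
rewrite /eucl_norm (bigD1 i)//= big1 => [|j ji].
  by rewrite !mxE eqxx addr0 sqrtr_sqr.
by rewrite !mxE (negbTE ji) subrr expr0n.
Qed.

Lemma lip_continuous u L : (forall x y, `|u x - u y| <= L * eucl_norm (x - y)) ->
  continuous u.
Proof.
move=> uL.
wlog L0 : L uL / 0 < L.
  move=> h; apply: (h (Num.max L 1)); last by rewrite lt_max ltr01 orbT.
  move=> x y; apply: (le_trans (uL x y)); rewrite ler_wpM2r ?eucl_norm_ge0//.
  by rewrite le_max lexx.
move=> x; apply/cvgrPdist_le => /= e e0; near=> y.
apply: (le_trans (uL _ _)); rewrite -ler_pdivlMl//.
apply: (le_trans (eucl_norm_le _)).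
(* The dimension [n] may be 0 here, so it is enlarged before dividing by it. *)
apply: (@le_trans _ _ (n.+1%:R * `|x - y|)); first by rewrite ler_wpM2r// ler_nat.
rewrite -ler_pdivlMl//; near: y; apply: cvgr_dist_le; first exact: cvg_id.
by rewrite !mulr_gt0// invr_gt0.
Unshelve. all: by end_near. Qed.

Lemma clip_lip t d a b : 0 < d -> `|clip t d a - clip t d b| <= d^-1 * `|a - b|.
Proof.
move=> d0.
have -> : d^-1 * `|a - b| = `|(a - t) / d - (b - t) / d|.
  rewrite mulrC -[in LHS](@gtr0_norm _ d^-1) ?invr_gt0// -normrM; congr `|_|; ring.
rewrite /clip; move: ((a - t) / d) ((b - t) / d) => p q.
have pq1 : p - q <= `|p - q| by exact: ler_norm.
have pq2 : q - p <= `|p - q| by rewrite distrC; exact: ler_norm.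
move: `|p - q| pq1 pq2 (normr_ge0 (p - q)) => N pq1 pq2 N0.
rewrite ler_norml /Num.min /Num.max.
by case: (ltP 0 p) => ?; case: (ltP 0 q) => ?; repeat (case: ltP => ?);
  apply/andP; split; lra.
Qed.

(** Balls of the sup norm are the cubes of the argument, with side [2 * r]; this brings them within
    reach of [poincare_box]. *)
Lemma ballE x r : 0 < r -> ball x r = box (fun i => ball (x 0 i) r).
Proof.
move=> r0; apply/seteqP; split=> [y [_ xy] i|y xy]; first exact: xy.
by split=> // i j; rewrite ord1; exact: xy.
Qed.

Lemma measurable_ball_rV x r : measurable (ball x r).
Proof. by apply: open_measurable_mx; exact: ball_open. Qed.

Lemma lebesgue_ball1 (a r : R) : 0 < r -> lebesgue_measure (ball a r) = (2 * r)%:E.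
Proof.
move=> r0; rewrite ball_itv lebesgue_measure_itv/= lte_fin ifT; last lra.
by rewrite -EFinD; congr EFin; lra.
Qed.

Lemma lebesgue_ball x r : 0 < r -> lebesgue_rV (ball x r) = ((2 * r) ^+ n)%:E.
Proof.
move=> r0; rewrite ballE// lebesgue_rV_box; last by move=> i; exact: measurable_ball.
under eq_bigr do rewrite lebesgue_ball1//.
by rewrite prodEFin prodr_const card_ord.
Qed.

Lemma measurable_upd x i : measurable_fun setT (fun s : measurableTypeR R => upd x i s).
Proof.
have cupd : continuous (fun s : R => upd x i s).
  rewrite (_ : (fun s => _) = (fun s => s *: basis i + upd x i 0)); last first.
    by apply/funext => s; rewrite -upd_shift addr0.
  by move=> s; apply: cvgD; [exact: scalel_continuous|exact: cvg_cst].
apply: (@measurability _ _ _ _ _ _ (@open 'rV[R]_n)) => //.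
move=> _ [U oU <-]; rewrite setTI; apply: open_measurable.
by apply: open_comp => // s _; exact: cupd.
Qed.

(** The gradient is measured in the l^1 norm, because Poincare's inequality is proved one axis at a
    time. *)
Definition layer_energy u (t d : R) x : R :=
  if t < `|u x| < t + d then \sum_(i < n) abs_partial u i x else 0.

Lemma measurable_layer_partial u t d i : continuous u ->
  measurable_fun setT
    (fun x => if t < `|u x| < t + d then abs_partial u i x else 0).
Proof.
move=> cu.
have mu : measurable_fun setT (fun x => `|u x|).
  by apply: measurableT_comp => //; exact: measurable_continuous_rV.
apply: measurable_fun_if => //.
- by apply: measurable_and; exact: measurable_fun_ltr.
- by apply: measurable_funTS; exact: measurable_abs_partial.
Qed.

(** On each coordinate line the truncation is Lipschitz in one variable, so [lipschitz_ftc_le] with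
    the bound of [derive_clip_le] supplies the oscillation hypothesis of [poincare_box]. *)
Lemma clip_poincare u L t d x r : (forall x y, `|u x - u y| <= L * eucl_norm (x - y)) ->
  0 <= t -> 0 < d -> 0 < r ->
  exists c, (\int[lebesgue_rV]_(y in ball x r) `|clip t d `|u y| - c|%:E <=
    (2 * r)%:E * \int[lebesgue_rV]_(y in ball x r) (d^-1 * layer_energy u t d y)%:E)%E.
Proof.
move=> uL t0 d0 r0; have cu := lip_continuous uL.
have d1 : 0 <= d^-1 by rewrite invr_ge0 ltW.
pose w y := clip t d `|u y|.
pose k i y := d^-1 * (if t < `|u y| < t + d then abs_partial u i y else 0).
have k0 i y : 0 <= k i y.
  by rewrite mulr_ge0//; case: ifP => _ //; exact: abs_partial_ge0.
have mk i : measurable_fun setT (k i).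
  by apply: measurable_funM => //; exact: measurable_layer_partial.
have wL y z : `|w y - w z| <= d^-1 * L * eucl_norm (y - z).
  rewrite -mulrA; apply: (le_trans (clip_lip _ _ _ d0)); rewrite ler_wpM2l//.
  exact: le_trans (ler_dist_dist _ _) (uL _ _).
have cw := lip_continuous wL.
pose A (i : 'I_n) : set (measurableTypeR R) := ball (x 0 i) r.
have mA i : measurable (A i) by exact: measurable_ball.
have lA i : lebesgue_measure (A i) = (2 * r)%:E by exact: lebesgue_ball1.
have mupd i y : measurable_fun setT (fun s : measurableTypeR R => upd y i s).
  exact: measurable_upd.
have kE0 i y : (0 <= (k i y)%:E)%E by rewrite lee_fin.
have mkE i : measurable_fun setT (fun y => (k i y)%:E) by exact/measurable_EFinP.
have kw i y a b : A i a -> A i b ->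
    (`|w (upd y i a) - w (upd y i b)|%:E <=
     \int[lebesgue_measure]_(s in A i) (k i (upd y i s))%:E)%E.
  wlog ab : a b / b <= a.
    move=> h Aa Ab; have [ab|/ltW ab] := leP b a; first exact: h.
    by rewrite distrC; exact: h.
  move=> Aa Ab.
  apply: (@le_trans _ _ (\int[lebesgue_measure]_(s in `[b, a]) (k i (upd y i s))%:E)%E).
    apply: (@lipschitz_ftc_le R (fun s => w (upd y i s)) (d^-1 * L)) => //.
    + by move=> p q; rewrite -(eucl_norm_upd y i p q); exact: wL.
    + exact: measurableT_comp (mk i) (mupd i y).
    + by move=> s; rewrite derivable_upd derive_upd; exact: derive_clip_le.
  apply: ge0_subset_integral => //.
  + by apply: measurable_funTS; exact: measurableT_comp (mkE i) (mupd i y).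
  + move=> s; move: Aa Ab; rewrite /A /ball/= in_itv/= !ltr_distl.
    by move=> /andP[? ?] /andP[? ?] /andP[? ?]; apply/andP; split; lra.
have r20 : 0 < 2 * r by rewrite mulr_gt0.
have [c cP] := poincare_box r20 mA lA (measurable_continuous_rV cw) mkE kE0 kw.
exists c; rewrite ballE//; apply: (le_trans cP).
apply: lee_wpmul2l; first by rewrite lee_fin mulr_ge0// ltW.
rewrite (eq_integral (fun y => (d^-1 * layer_energy u t d y)%:E))// => y _.
rewrite sumEFin -mulr_sumr /layer_energy; congr (_ * _)%:E.
by case: ifP => _ //; rewrite big1.
Qed.
End partial_derivatives.

(** * Vitali covering and the maximal function *)

(** Both integrals are suprema over simple functions below the integrand, so monotonicity holds for
    arbitrary nonnegative functions. It serves the right-hand side of the theorem, where [grad u]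
    takes arbitrary values off the points of derivability. *)
Lemma ge0_le_integral_measurable_left d (T : measurableType d) (R : realType)
    (mu : {measure set T -> \bar R}) (f1 f2 : T -> \bar R) :
  (forall x, 0 <= f1 x)%E -> (forall x, f1 x <= f2 x)%E ->
  (\int[mu]_x f1 x <= \int[mu]_x f2 x)%E.
Proof.
move=> f10 f12.
have f20 x : (0 <= f2 x)%E by exact: le_trans (f12 x).
rewrite !ge0_integralTE//; apply: le_ereal_sup => _ [h /= hf1 <-].
by exists h => // x; exact: le_trans (f12 x).
Qed.

Lemma le_measure_bigsetU d (T : measurableType d) (R : realType)
    (mu : {measure set T -> \bar R}) (I : eqType) (s : seq I) (A : set T)
    (F : I -> set T) : measurable A -> (forall i, measurable (F i)) ->
  A `<=` \big[setU/set0]_(i <- s) F i -> (mu A <= \sum_(i <- s) mu (F i))%E.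
Proof.
move=> + mF; elim: s A => [|i s IHs] A mA.
  by rewrite !big_nil subset0 => ->; rewrite measure0.
rewrite !big_cons => AF.
have mAF : measurable (A `&` F i) by exact: measurableI.
have mADF : measurable (A `\` F i) by exact: measurableD.
have -> : A = (A `&` F i) `|` (A `\` F i) by rewrite setUIDK.
apply: (le_trans (measureU2 _ _ _)) => //.
apply: leeD; first by rewrite le_measure ?inE// => x [].
by apply: IHs => // x [/AF[//|]].
Qed.

(** With the radii sorted increasingly, induction treats the larger balls first. The head ball has
    the smallest radius: if it meets a selected ball it lies in the triple of that ball, otherwise
    it is selected too. *)
Lemma vitali_cover_finite (R : realFieldType) (V : pseudoMetricType R) (I : eqType)
    (x : I -> V) (r : I -> R) (s : seq I) : (forall i, 0 <= r i) ->
  exists D : seq I, [/\ uniq D, {subset D <= s},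
    trivIset [set` D] (fun i => ball (x i) (r i)) &
    forall i, i \in s -> exists2 j, j \in D &
      ball (x i) (r i) `<=` ball (x j) (3 * r j)].
Proof.
move=> r0; pose B i := ball (x i) (r i).
pose LE i j := r i <= r j.
have LE_trans : transitive LE by move=> ? ? ?; exact: le_trans.
wlog sLE : s / sorted LE s.
  have LEs : sorted LE (sort LE s) by apply: sort_sorted => ? ?; exact: le_total.
  move=> /(_ _ LEs)[D [uD Ds tD cD]]; exists D; split => //.
    by move=> i /Ds; rewrite mem_sort.
  by move=> i si; apply: cD; rewrite mem_sort.
elim: s sLE => [_|i s IHs /= si]; first by exists [::]; split => // j k /=.
have [D [uD Ds tD cD]] := IHs (path_sorted si).
have ri j : j \in s -> r i <= r j.
  by move: si => /(order_path_min LE_trans)/allP; exact.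
have [[j jD [z [iz jz]]]|noint] := pselect (exists2 j, j \in D & B i `&` B j !=set0).
  exists D; split => //; first by move=> k /Ds ks; rewrite in_cons ks orbT.
  move=> k /[!in_cons]/predU1P[->|]; last exact: cD.
  exists j => // y iy.
  have -> : 3 * r j = r j + (r j + r j) by ring.
  apply: ball_triangle jz _; apply: (@ball_triangle _ _ (x i)).
    by apply: ball_sym; apply: (le_ball (ri _ (Ds _ jD))).
  exact: (le_ball (ri _ (Ds _ jD))).
(* A ball of radius 0 may be empty and so miss even itself; with a repetition in [s], [i] can then
   already be in [D]. *)
have [iD|iD] := boolP (i \in D).
  exists D; split => //; first by move=> k /Ds ks; rewrite in_cons ks orbT.
  move=> k /[!in_cons]/predU1P[->|]; last exact: cD.
  by exists i => //; apply: le_ball; rewrite ler_peMl ?ler1n.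
exists (i :: D); split => //=.
- by rewrite iD.
- move=> k /[!in_cons]/predU1P[->|/Ds ks]; first by rewrite eqxx.
  by rewrite ks orbT.
- move=> k l /=; rewrite !in_cons => /predU1P[->|kD] /predU1P[->|lD] // kl.
  + by exfalso; apply: noint; exists l.
  + by exfalso; apply: noint; exists k => //; rewrite setIC.
  + exact: tD.
- move=> k /[!in_cons]/predU1P[->|ks].
    exists i; first by rewrite mem_head.
    by apply: le_ball; rewrite ler_peMl ?ler1n.
  by have [j jD kj] := cD _ ks; exists j => //; rewrite in_cons jD orbT.
Qed.

Section cube_estimates.
Context {R : realType} {m : nat}.
Local Notation n := m.+1.
Local Notation V := 'rV[R]_n.
Implicit Types (u : V -> R) (x y : V) (mu : {measure set V -> \bar R}).

(** The truncation is 1 on the first set and 0 on the second. Any constant [c] is at distance at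
    least 1/2 from one of these two values, which bounds the left side of [clip_poincare] from below
    by [q / 2]. *)
Lemma clip_energy_ge u L t d x r (q : R) :
  (forall x y, `|u x - u y| <= L * eucl_norm (x - y)) ->
  0 <= t -> 0 < d -> 0 < r -> 0 <= q ->
  (q%:E <= lebesgue_rV (ball x r `&` [set y | (t + d <= `|u y|)%R]))%E ->
  (q%:E <= lebesgue_rV (ball x r `&` [set y | (`|u y| <= t)%R]))%E ->
  ((q / 2)%:E <=
    (2 * r)%:E * \int[lebesgue_rV]_(y in ball x r) (d^-1 * layer_energy u t d y)%:E)%E.
Proof.
move=> uL t0 d0 r0 q0 hi lo.
have cu := lip_continuous uL.
have [c cP] := clip_poincare x uL t0 d0 r0; apply: le_trans cP.
have mu' := measurable_norm_continuous cu.
have mw : measurable_fun setT (fun y => `|clip t d `|u y| - c|%:E).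
  apply/measurable_EFinP; apply: measurableT_comp => //; apply: measurable_funB => //.
  apply: measurable_minr => //; apply: measurable_maxr => //.
  by apply: measurable_funM => //; exact: measurable_funB.
have key (S : set V) : measurable S -> (forall y, S y -> 1 / 2 <= `|clip t d `|u y| - c|) ->
    (q%:E <= lebesgue_rV (ball x r `&` S))%E ->
    ((q / 2)%:E <= \int[lebesgue_rV]_(y in ball x r) `|clip t d `|u y| - c|%:E)%E.
  move=> mS Sc qS.
  have mI : measurable (ball x r `&` S).
    by apply: measurableI => //; exact: measurable_ball_rV.
  apply: (@le_trans _ _ (\int[lebesgue_rV]_(y in ball x r `&` S) (cst (1 / 2)%:E y))%E).
    rewrite integral_cst// mulrC EFinM mul1r; exact: lee_wpmul2l.
  apply: (@le_trans _ _ (\int[lebesgue_rV]_(y in ball x r `&` S) `|clip t d `|u y| - c|%:E)%E).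
    apply: ge0_le_integral => //.
    - by move=> y _; rewrite lee_fin divr_ge0.
    - exact: measurable_funTS.
    - by move=> y [_ Sy]; rewrite lee_fin; exact: Sc.
  apply: ge0_subset_integral => //.
  - exact: measurable_ball_rV.
  - exact: measurable_funTS.
have [c2|c2] := leP c (1 / 2).
  apply: key hi.
    by rewrite -[X in measurable X]setTI; apply: measurable_fun_le.
  move=> y /= tu.
  have -> : clip t d `|u y| = 1.
    have ? : 1 <= (`|u y| - t) / d by rewrite ler_pdivlMr// mul1r lerBrDl.
    by rewrite /clip max_r ?min_l// (le_trans ler01).
  by rewrite ger0_norm; lra.
apply: key lo.
  by rewrite -[X in measurable X]setTI; apply: measurable_fun_le.
move=> y /= tu.
have -> : clip t d `|u y| = 0.
  by rewrite /clip max_l ?min_r// pmulr_lle0 ?invr_gt0// subr_le0.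
by rewrite sub0r normrN ger0_norm; lra.
Qed.

(* With cubes instead of Euclidean balls the maximal function is lower
   semicontinuous without any appeal to translation invariance. *)
Definition cube_maximal mu y : \bar R :=
  ereal_sup [set ((r ^- m)%:E * mu (ball y r))%E | r in [set r : R | 0 < r]].

Lemma cube_maximal_ge0 mu y : (0 <= cube_maximal mu y)%E.
Proof.
apply: (@le_trans _ _ ((1 ^- m)%:E * mu (ball y 1))%E).
  by apply: mule_ge0 => //; rewrite lee_fin expr1n invr1.
by apply: ereal_sup_ubound; exists 1 => //=.
Qed.

(** The tripled cube lies in [ball y (4 * r)], which competes in the supremum at [y]. *)
Lemma measure_ball_le_cube_maximal mu x y (r : R) : 0 < r -> ball x r y ->
  (mu (ball x (3 * r)) <= ((4 * r) ^+ m)%:E * cube_maximal mu y)%E.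
Proof.
move=> r0 xy; have r40 : 0 < (4 * r) ^+ m by rewrite exprn_gt0// mulr_gt0.
apply: (@le_trans _ _ (mu (ball y (4 * r)))).
  rewrite le_measure ?inE; [|exact: measurable_ball_rV|exact: measurable_ball_rV|] => //.
  move=> z xz; have -> : 4 * r = r + 3 * r by ring.
  by apply: ball_triangle xz; exact: ball_sym.
rewrite muleC -lee_pdivrMr// muleC.
by apply: ereal_sup_ubound; exists (4 * r) => //=; rewrite mulr_gt0.
Qed.

(** By continuity from below, a slightly smaller concentric cube already beats [a]; that cube is
    contained in [ball z r] for every [z] close to [y]. *)
Lemma open_cube_maximal mu (a : \bar R) : open [set y | (a < cube_maximal mu y)%E].
Proof.
rewrite openE => y /= /ereal_sup_gt[_ [r /= r0 <-] ar].
pose F k := ball y (r - k.+1%:R^-1).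
have Fcup : \bigcup_k F k = ball y r.
  apply/seteqP; split => [z [k _]|z yz].
    by apply: le_ball; rewrite gerBl invr_ge0.
  have zr : `|y - z| < r by move: yz; rewrite -ball_normE.
  have zr0 : 0 < r - `|y - z| by rewrite subr_gt0.
  have [k _ /(_ k (leqnn _)) ke] := near_infty_natSinv_lt (PosNum zr0).
  by exists k => //; rewrite /F -ball_normE /= ltrBrDl -ltrBrDr.
have cF : mu \o F @ \oo --> mu (ball y r).
  rewrite -Fcup; apply: nondecreasing_cvg_mu.
  - by move=> k; exact: measurable_ball_rV.
  - by rewrite Fcup; exact: measurable_ball_rV.
  - move=> k l kl; apply/subsetPset => z; apply: le_ball.
    by rewrite lerB// lef_pV2 ?posrE// ler_nat.
have rm0 : 0 < r ^- m by rewrite invr_gt0 exprn_gt0.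
have [k ak] : exists k, (a < (r ^- m)%:E * mu (F k))%E.
  have cF2 : (fun k => (r ^- m)%:E * mu (F k))%E @ \oo --> ((r ^- m)%:E * mu (ball y r))%E.
    by apply: cvgeZl.
  have /filter_ex[k ak] : \forall k \near \oo, (a < (r ^- m)%:E * mu (F k))%E.
    exact: (cF2 _ (open_ereal_gt' ar)).
  by exists k.
apply/nbhs_ballP; exists k.+1%:R^-1 => /=; first by rewrite invr_gt0.
move=> z yz /=; apply: (lt_le_trans ak).
apply: (@le_trans _ _ ((r ^- m)%:E * mu (ball z r))%E); last first.
  by apply: ereal_sup_ubound; exists r.
apply: lee_wpmul2l; first by rewrite lee_fin ltW.
rewrite le_measure ?inE; [|exact: measurable_ball_rV|exact: measurable_ball_rV|] => //.
move=> w yw; rewrite -(subrK k.+1%:R^-1 r) addrC.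
by apply: ball_triangle yw; exact: ball_sym.
Qed.

Lemma measurable_cube_maximal mu : measurable_fun setT (cube_maximal mu).
Proof.
apply: (measurability _ (ErealGenOInfty.measurableE R)).
move=> /= _ [_ [a ->]] <-; apply: measurableI => //; apply: open_measurable_mx.
by rewrite preimage_itvoy; exact: open_cube_maximal.
Qed.

Lemma open_eucl_ball x r : open (eucl_ball x r).
Proof.
have ci i : continuous (fun y : V => (y - x) 0 i).
  rewrite (_ : (fun y => _) = (fun y : V => y 0 i - x 0 i)); last first.
    by apply/funext => y; rewrite !mxE.
  by move=> y; apply: cvgB; [exact: coord_continuous|exact: cvg_cst].
have cs : continuous (fun y : V => \sum_i (y - x) 0 i ^+ 2).
  apply: (@continuous_big R 'I_n +%R 0 xpredT) => [|i _ y].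
    exact: add_continuous.
  exact: (cvgM (ci i y) (ci i y)).
have c : continuous (fun y : V => eucl_norm (y - x)).
  move=> y; apply: (@continuous_comp _ _ _ (fun y => \sum_i (y - x) 0 i ^+ 2) Num.sqrt).
    exact: cs.
  exact: sqrt_continuous.
rewrite (_ : eucl_ball x r = (fun y => eucl_norm (y - x)) @^-1` [set s | s < r])//.
by apply: open_comp => // y _; exact: c.
Qed.

(** The Euclidean ball of radius [p = n%:R * r] contains the cube of radius [r] and lies in the cube
    of radius [p]. The inner cube makes its volume positive; the outer one bounds it by
    [(2 * p) ^+ n], and [(2 * p) ^+ n / (p * r ^+ m)] is the stated constant. *)
Lemma cube_maximal_le mu y :
  (cube_maximal mu y <= (2 ^+ n * n%:R ^+ m)%:E * frac_maximal 1 mu y)%E.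
Proof.
apply: ge_ereal_sup => _ [r /= r0 <-].
pose p := n%:R * r.
have p0 : 0 < p by rewrite mulr_gt0.
pose B := eucl_ball y p.
have mB : measurable B by apply: open_measurable_mx; exact: open_eucl_ball.
have rB : ball y r `<=` B.
  move=> z; rewrite -ball_normE /= => yz; apply: (le_lt_trans (eucl_norm_le _)).
  by rewrite ltr_pM2l// distrC.
have Bp : B `<=` ball y p.
  move=> z zy; split => // i j; rewrite ord1 /ball/= distrC.
  by apply: le_lt_trans zy; have := ler_coord_eucl (z - y) j; rewrite !mxE.
have lB1 : (lebesgue_rV B <= ((2 * p) ^+ n)%:E)%E.
  rewrite -(lebesgue_ball y p0) le_measure ?inE//; exact: measurable_ball_rV.
have lB2 : (((2 * r) ^+ n)%:E <= lebesgue_rV B)%E.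
  rewrite -(lebesgue_ball y r0) le_measure ?inE//; exact: measurable_ball_rV.
have r2 : 0 < (2 * r) ^+ n by rewrite exprn_gt0// mulr_gt0.
have [b bE] : exists b, lebesgue_rV B = b%:E.
  exists (fine (lebesgue_rV B)); rewrite fineK// ge0_fin_numE//.
  exact: le_lt_trans lB1 (ltry _).
rewrite bE !lee_fin in lB1 lB2.
have b0 : 0 < b by exact: lt_le_trans lB2.
apply: (@le_trans _ _ ((r ^- m)%:E * mu B)%E).
  apply: lee_wpmul2l; first by rewrite lee_fin invr_ge0 exprn_ge0// ltW.
  rewrite le_measure ?inE//; exact: measurable_ball_rV.
apply: (@le_trans _ _ ((2 ^+ n * n%:R ^+ m)%:E * ((p `^ 1)%:E * (mu B / b%:E)))%E); last first.
  apply: lee_wpmul2l; first by rewrite lee_fin mulr_ge0// exprn_ge0.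
  by apply: ereal_sup_ubound; exists p => //; rewrite /= -bE.
rewrite powRr1; last exact: ltW.
rewrite inver gt_eqF// [(mu B * _)%E]muleC !muleA -!EFinM.
apply: lee_wpmul2r => //; rewrite lee_fin.
rewrite ler_pdivlMr// -ler_pdivlMl ?invr_gt0 ?exprn_gt0// invrK.
apply: (le_trans lB1); rewrite /p !exprMn exprS [n%:R ^+ n]exprS [r ^+ n]exprS.
by rewrite le_eqVlt; apply/orP; left; apply/eqP; ring.
Qed.

End cube_estimates.

(** * Level sets *)

Section level_sets.
Context {R : realType} {m : nat}.
Local Notation n := m.+1.
Local Notation V := 'rV[R]_n.
Implicit Types (u : V -> R) (x y : V) (mu : {measure set V -> \bar R}).
Local Notation leb := (@lebesgue_rV R n).

Definition superlevel u (t : R) : set V := [set y | t < `|u y|].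

Definition layer u (t d : R) : set V := [set y | t < `|u y| < t + d].

Lemma measurable_superlevel u t : continuous u -> measurable (superlevel u t).
Proof.
move=> cu; apply: open_measurable_mx.
apply: (@open_comp _ _ (fun y => `|u y|) [set z | t < z]); last exact: open_gt.
by move=> y _; apply: cvg_norm; exact: cu.
Qed.

Lemma measurable_layer u t d : continuous u -> measurable (layer u t d).
Proof.
move=> cu.
have -> : layer u t d = superlevel u t `&` [set y | `|u y| < t + d].
  by apply/seteqP; split=> y /=; [move=> /andP[]|move=> [p q]; apply/andP].
apply: measurableI; first exact: measurable_superlevel.
apply: open_measurable_mx.
apply: (@open_comp _ _ (fun y => `|u y|) [set z | z < t + d]); last exact: open_lt.
by move=> y _; apply: cvg_norm; exact: cu.
Qed.

Lemma layer_energy_ge0 u t d x : 0 <= layer_energy u t d x.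
Proof.
rewrite /layer_energy; case: ifP => // _.
by apply: sumr_ge0 => i _; exact: abs_partial_ge0.
Qed.

Lemma measurable_layer_energy u t d : continuous u ->
  measurable_fun setT (fun y => (d^-1 * layer_energy u t d y)%:E).
Proof.
move=> cu; apply/measurable_EFinP; apply: measurable_funM => //.
have mu' := measurable_norm_continuous cu.
apply: measurable_fun_if => //.
- by apply: measurable_and; exact: measurable_fun_ltr.
- by apply: measurable_funTS; apply: measurable_sum => i; exact: measurable_abs_partial.
Qed.

Lemma compact_sub_ball (K : set V) : compact K -> exists2 M, 0 < M & K `<=` ball 0 M.
Proof.
move=> /compact_bounded[M [_ MK]]; exists (`|M| + 2); first by rewrite ltr_wpDl.
move=> y Ky; rewrite -ball_normE /= sub0r normrN.
apply: (@le_lt_trans _ _ (`|M| + 1)); last by rewrite ltrD2l ltr1n.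
by apply: MK => //; rewrite (le_lt_trans (ler_norm _))// ltrDl.
Qed.

Lemma lebesgue_superlevel_fin u t : compact (closure [set x | u x != 0]) -> 0 <= t ->
  continuous u -> (leb (superlevel u t) < +oo)%E.
Proof.
move=> /compact_sub_ball[M M0 KM] t0 cu.
apply: (@le_lt_trans _ _ (leb (ball 0 M))).
  rewrite le_measure ?inE//; [exact: measurable_superlevel|exact: measurable_ball_rV|].
  move=> y; rewrite /superlevel/= => tu; apply/KM/subset_closure => /=.
  by rewrite -normr_gt0 (le_lt_trans t0).
by rewrite lebesgue_ball// ltry.
Qed.

(** The inequality [t < |u|] being strict, the layers decrease to the empty set; they all lie in a
    superlevel set of finite measure. *)
Lemma lebesgue_layer_cvg0 u t : compact (closure [set x | u x != 0]) -> 0 <= t ->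
  continuous u -> (fun k => leb (layer u t k.+1%:R^-1)) @ \oo --> 0%E.
Proof.
move=> cs t0 cu; pose F k := layer u t k.+1%:R^-1.
have mF k : measurable (F k) by exact: measurable_layer.
have F0 : \bigcap_k F k = set0.
  apply/seteqP; split=> // y Fy.
  have /andP[tu _] := Fy 0%N I.
  have ut0 : 0 < `|u y| - t by rewrite subr_gt0.
  have [k _ /(_ k (leqnn _)) ke] := near_infty_natSinv_lt (PosNum ut0).
  have {}ke : k.+1%:R^-1 < `|u y| - t by [].
  have /andP[_] := Fy k I; rewrite -ltrBlDl => uk.
  by have := lt_trans uk ke; rewrite ltxx.
rewrite -[X in _ --> X](measure0 leb) -F0; apply: nonincreasing_cvg_mu => //.
- apply: le_lt_trans (lebesgue_superlevel_fin cs t0 cu).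
  apply: le_measure; rewrite ?inE; [exact: (mF 0%N)|exact: measurable_superlevel|].
  by move=> y /andP[].
- by rewrite F0.
- move=> k l kl; apply/subsetPset => y /andP[tu uk]; apply/andP; split => //.
  by apply: (lt_le_trans uk); rewrite lerD2l lef_pV2 ?posrE// ler_nat.
Qed.

(** Doubling from [r0] stops at the first cube in which [E] fills at most half. It is not the
    initial cube, which lies in [E], so its predecessor is more than half filled, and that amount is
    at least [r ^+ n / 2] in terms of the final radius. *)
Lemma stopping_cube (E : set V) x (r0 : R) : measurable E -> (leb E < +oo)%E ->
  0 < r0 -> ball x r0 `<=` E ->
  exists r, [/\ r0 <= r, ((r ^+ n / 2)%:E <= leb (ball x r `&` E))%E &
    (((2 * r) ^+ n / 2)%:E <= leb (ball x r `\` E))%E].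
Proof.
move=> mE Eoo r0p xE.
pose rad j : R := 2 ^+ j * r0.
have radp j : 0 < rad j by rewrite mulr_gt0// exprn_gt0.
have mB j : measurable (ball x (rad j)) by exact: measurable_ball_rV.
have mBE j : measurable (ball x (rad j) `&` E) by exact: measurableI.
pose v j := fine (leb (ball x (rad j) `&` E)).
have vE j : leb (ball x (rad j) `&` E) = (v j)%:E.
  rewrite fineK// ge0_fin_numE//; apply: le_lt_trans Eoo.
  by rewrite le_measure ?inE// => y [].
pose P j := v j <= (2 * rad j) ^+ n / 2.
have exP : exists j, P j.
  pose w := fine (leb E).
  have wE : leb E = w%:E by rewrite fineK// ge0_fin_numE.
  have w0 : 0 <= w by rewrite -lee_fin -wE.
  (* Since [2 ^+ j] exceeds [j], the radius is at least [1 + w]. The summand 1 keeps [2 * rad j]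
     above 1, so its [n]-th power is at least itself. *)
  pose j := (Num.truncn ((1 + w) / r0)).+1; exists j.
  have jw : 1 + w <= rad j.
    rewrite /rad -ler_pdivrMr//; apply: (@le_trans _ _ j%:R).
      by rewrite ltW// truncnS_gt.
    by rewrite -natrX ler_nat ltnW// ltn_expl.
  rewrite /P; apply: (@le_trans _ _ w).
    by rewrite -lee_fin -vE -wE le_measure ?inE// => y [].
  apply: (@le_trans _ _ (2 * rad j / 2)); first by lra.
  rewrite ler_pM2r ?invr_gt0// -[leLHS]expr1; apply: ler_weXn2l => //; lra.
case: (ex_minnP exP) => -[|j] Pj minj.
  exfalso; move: Pj; apply/negP; rewrite /P -ltNge.
  have rad0 : rad 0%N = r0 by rewrite /rad expr0 mul1r.
  rewrite -lte_fin -vE (setIidl _) ?rad0// lebesgue_ball// lte_fin.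
  have : 0 < (2 * r0) ^+ n by rewrite exprn_gt0// mulr_gt0.
  lra.
have nPj : ~~ P j by apply/negP => /minj; rewrite ltnn.
exists (rad j.+1); split.
- by rewrite /rad ler_peMl ?(ltW r0p)// -natrX ler1n expn_gt0.
- rewrite vE lee_fin; move: nPj; rewrite /P -ltNge => /ltW nPj.
  have -> : rad j.+1 = 2 * rad j by rewrite /rad exprS mulrA.
  apply: (le_trans nPj); rewrite -lee_fin -!vE le_measure ?inE// => y [yx yE]; split => //.
  by apply: le_ball yx; rewrite /rad ler_pM2r// -!natrX ler_nat leq_exp2l.
have : leb (ball x (rad j.+1)) =
    (leb (ball x (rad j.+1) `\` E) + leb (ball x (rad j.+1) `&` E))%E.
  exact: measureDI.
rewrite lebesgue_ball// vE.
case: (leb (ball x (rad j.+1) `\` E)) => [s|_|//]; last by rewrite leey.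
by rewrite -EFinD => -[sE]; rewrite lee_fin; move: Pj; rewrite /P; lra.
Qed.

(** Once the thin layer is removed, both extreme values of the truncation occupy measure at least
    [r ^+ n / 4], so [clip_energy_ge] applies. Multiplying its conclusion by the measure of the
    tripled cube, and bounding that measure pointwise under the integral by [(4 * r) ^+ m] times the
    maximal function, leaves the constant [8 * 2 * 4 ^+ m]. *)
Lemma cube_estimate mu u L t d x r :
  (forall x y, `|u x - u y| <= L * eucl_norm (x - y)) ->
  0 <= t -> 0 < d -> 0 < r ->
  ((r ^+ n / 2)%:E <= leb (ball x r `&` superlevel u t))%E ->
  (((2 * r) ^+ n / 2)%:E <= leb (ball x r `\` superlevel u t))%E ->
  (leb (layer u t d) <= (r ^+ n / 4)%:E)%E ->
  (mu (ball x (3 * r)) <= (4 ^+ m.+2)%:E *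
    \int[leb]_(y in ball x r) ((d^-1 * layer_energy u t d y)%:E * cube_maximal mu y))%E.
Proof.
move=> uL t0 d0 r0 hE hnE hl.
have cu := lip_continuous uL.
have mball s : measurable (ball x s) by exact: measurable_ball_rV.
have rn0 : 0 < r ^+ n by rewrite exprn_gt0.
have mu' := measurable_norm_continuous cu.
pose S := [set y | t + d <= `|u y|].
have mS : measurable S by rewrite -[X in measurable X]setTI; apply: measurable_fun_le.
(* Of the measure [r ^+ n / 2] of the superlevel set in the cube, the layer takes away at most
   half. *)
have hi : ((r ^+ n / 4)%:E <= leb (ball x r `&` S))%E.
  have sub : (leb (ball x r `&` superlevel u t) <=
      leb (ball x r `&` S) + leb (layer u t d))%E.
    apply: (@le_trans _ _ (leb ((ball x r `&` S) `|` layer u t d))).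
      rewrite le_measure ?inE//.
      - by apply: measurableI => //; exact: measurable_superlevel.
      - by apply: measurableU; [exact: measurableI|exact: measurable_layer].
      move=> y [yx tu]; have [uy|uy] := leP (t + d) `|u y|; first by left.
      by right; apply/andP.
    by apply: measureU2; [exact: measurableI|exact: measurable_layer].
  have [a aE] : exists a, leb (layer u t d) = a%:E.
    exists (fine (leb (layer u t d))); rewrite fineK// ge0_fin_numE//.
    exact: le_lt_trans hl (ltry _).
  have := le_trans hE sub; move: hl; rewrite aE lee_fin.
  case: (leb (ball x r `&` S)) => [b|_ _|//]; last by rewrite leey.
  by rewrite -EFinD !lee_fin; lra.
have lo : ((r ^+ n / 4)%:E <= leb (ball x r `&` [set y | (`|u y| <= t)%R]))%E.
  apply: (@le_trans _ _ ((2 * r) ^+ n / 2)%:E).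
    rewrite lee_fin exprMn; have : (1 : R) <= 2 ^+ n by rewrite -natrX ler1n expn_gt0.
    move: rn0; move: (r ^+ n) (2 ^+ n : R) => a b a0 b1; nra.
  apply: (le_trans hnE); rewrite le_measure ?inE//.
  - by apply: measurableD => //; exact: measurable_superlevel.
  - apply: measurableI => //.
    by rewrite -[X in measurable X]setTI; apply: measurable_fun_le.
  by move=> y [yx /negP]; rewrite /superlevel -leNgt.
have q0 : 0 <= r ^+ n / 4 by rewrite divr_ge0// ltW.
have := clip_energy_ge uL t0 d0 r0 q0 hi lo.
set g := fun y => (d^-1 * layer_energy u t d y)%:E.
have g0 y : (0 <= g y)%E.
  by rewrite lee_fin mulr_ge0 ?invr_ge0 ?(ltW d0)//; exact: layer_energy_ge0.
have mg : measurable_fun setT g.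
  exact: measurable_layer_energy.
move=> energy.
set a := mu (ball x (3 * r)).
have a0 : (0 <= a)%E by exact: measure_ge0.
have mN := measurable_cube_maximal mu.
have N0 y := cube_maximal_ge0 mu y.
have aN : (a * \int[leb]_(y in ball x r) g y <=
    ((4 * r) ^+ m)%:E * \int[leb]_(y in ball x r) (g y * cube_maximal mu y))%E.
  rewrite -ge0_integralZl//; last exact: measurable_funTS.
  rewrite -ge0_integralZl//; last 3 first.
  - by apply: measurable_funTS; exact: emeasurable_funM.
  - by move=> y _; exact: mule_ge0.
  - by rewrite lee_fin exprn_ge0// mulr_ge0// ltW.
  apply: ge0_le_integral => //.
  - by move=> y _; exact: mule_ge0.
  - by apply: measurable_funTS; apply: emeasurable_funM.
  - by apply: measurable_funTS; apply: emeasurable_funM => //; exact: emeasurable_funM.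
  move=> y xy; rewrite muleCA muleC; apply: lee_wpmul2l => //.
  exact: measure_ball_le_cube_maximal.
set J := (\int[leb]_(y in ball x r) (g y * cube_maximal mu y))%E in aN *.
have J0 : (0 <= J)%E by apply: integral_ge0 => y _; exact: mule_ge0.
have r80 : 0 < r ^+ n / 4 / 2 by rewrite !divr_gt0.
rewrite -(@lee_pmul2l _ (r ^+ n / 4 / 2)%:E)//.
have -> : ((r ^+ n / 4 / 2)%:E * ((4 ^+ m.+2)%:E * J) =
    (2 * r)%:E * (((4 * r) ^+ m)%:E * J))%E.
  rewrite !muleA -!EFinM; congr (_%:E * _)%E.
  by rewrite exprMn !exprS; field.
apply: (@le_trans _ _ ((2 * r)%:E * (a * \int[leb]_(y in ball x r) g y)))%E.
  by rewrite muleCA muleC; apply: lee_wpmul2l.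
by apply: lee_wpmul2l => //; rewrite lee_fin mulr_ge0// ltW.
Qed.

(** The stopping radii are all at least [r0], which does not depend on [k]. Hence a single smallness
    condition on the layer, true for all large [k], serves every cube of the covering. *)
Lemma level_set_estimate mu u L t e :
  (forall x y, `|u x - u y| <= L * eucl_norm (x - y)) ->
  compact (closure [set x | u x != 0]) -> 0 <= t -> 0 < e ->
  \forall k \near \oo, (mu [set y | (t + e <= `|u y|)%R] <= (4 ^+ m.+2)%:E *
    \int[leb]_y ((k.+1%:R * layer_energy u t k.+1%:R^-1 y)%:E * cube_maximal mu y))%E.
Proof.
move=> uL cs t0 e0; have cu := lip_continuous uL.
wlog L0 : L uL / 0 < L.
  move=> h; apply: (h (Num.max L 1)); last by rewrite lt_max ltr01 orbT.
  move=> x y; apply: (le_trans (uL x y)); rewrite ler_wpM2r ?eucl_norm_ge0//.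
  by rewrite le_max lexx.
(* For the sup norm [u] has Lipschitz constant [L * n%:R], so [|u|] drops by at most [e / 2] within
   distance [r0] and stays above [t]. *)
pose r0 := e / 2 / (L * n%:R).
have r0p : 0 < r0 by rewrite !divr_gt0// mulr_gt0.
have mE := measurable_superlevel t cu.
have Eoo := lebesgue_superlevel_fin cs t0 cu.
pose S := [set y | t + e <= `|u y|].
have cau : continuous (fun y => `|u y|) by move=> y; apply: cvg_norm; exact: cu.
have clS : closed S.
  by apply: (@closed_comp _ _ (fun y => `|u y|) [set z | t + e <= z]) => [y _|];
    [exact: cau|exact: closed_ge].
have cS : compact S.
  apply: (subclosed_compact clS cs) => y Sy; apply: subset_closure => /=.
  by rewrite -normr_gt0 (lt_le_trans _ Sy)// ltr_wpDl.
have mS : measurable S by exact: closed_measurable_rV.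
have ballE x : S x -> ball x r0 `<=` superlevel u t.
  move=> Sx y; rewrite -ball_normE /= => xy.
  have : `|u x| - `|u y| <= e / 2.
    apply: (le_trans (ler_norm _)); apply: (le_trans (ler_dist_dist _ _)).
    apply: (le_trans (uL _ _)); rewrite -ler_pdivlMl//.
    apply: (le_trans (eucl_norm_le _)); rewrite -ler_pdivlMl//.
    apply: (le_trans (ltW xy)); rewrite /r0 invfM.
    by rewrite le_eqVlt; apply/orP; left; apply/eqP; ring.
  by move: Sx; rewrite /S /superlevel /=; lra.
(* Off [S] the value [r0] is a placeholder that keeps every radius positive, as the covering lemma
   is applied with all points as indices. *)
have /choice[r rP] : forall x, exists r, r0 <= r /\ (S x ->
    ((r ^+ n / 2)%:E <= leb (ball x r `&` superlevel u t))%E /\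
    (((2 * r) ^+ n / 2)%:E <= leb (ball x r `\` superlevel u t))%E).
  move=> x; have [Sx|nSx] := pselect (S x); last by exists r0.
  by have [r [? ? ?]] := stopping_cube mE Eoo r0p (ballE _ Sx); exists r.
have rp x : 0 < r x by apply: lt_le_trans (rP x).1.
have := cS; rewrite compact_cover => /(_ _ S (fun x => ball x (r x))).
case => [x _|x Sx|D' D'S SD']; first exact: ball_open.
  by exists x => //; apply: ballxx.
have [D [uD DD' tD cD]] :=
  @vitali_cover_finite R V V id r (finmap.enum_fset D') (fun x => ltW (rp x)).
have DS x : x \in D -> S x by move=> /DD' xD; have := D'S _ xD; rewrite inE.
have small : \forall k \near \oo, (leb (layer u t k.+1%:R^-1) <= (r0 ^+ n / 4)%:E)%E.
  have r4 : (0 < (r0 ^+ n / 4)%:E)%E by rewrite lte_fin divr_gt0// exprn_gt0.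
  have lcvg := lebesgue_layer_cvg0 cs t0 cu.
  have : \forall k \near \oo, (leb (layer u t k.+1%:R^-1) < (r0 ^+ n / 4)%:E)%E.
    exact: (lcvg _ (open_ereal_lt' r4)).
  by apply: filterS => k /ltW.
apply: filterS small => k hk.
set g := fun y => ((k.+1%:R * layer_energy u t k.+1%:R^-1 y)%:E * cube_maximal mu y)%E.
have g0 y : (0 <= g y)%E.
  apply: mule_ge0 (cube_maximal_ge0 _ _); rewrite lee_fin mulr_ge0//.
  exact: layer_energy_ge0.
have mg : measurable_fun setT g.
  apply: emeasurable_funM (measurable_cube_maximal mu).
  have := measurable_layer_energy t k.+1%:R^-1 cu.
  by rewrite invrK.
have mB x : measurable (ball x (r x)) by exact: measurable_ball_rV.
apply: (@le_trans _ _ (\sum_(x <- D) mu (ball x (3 * r x)))%E).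
  apply: le_measure_bigsetU => //; first by move=> x; exact: measurable_ball_rV.
  move=> y /SD'[x /= xD' xy]; have [j jD /(_ _ xy) jy] := cD _ xD'.
  by rewrite -bigcup_seq; exists j.
apply: (@le_trans _ _ (\sum_(x <- D) (4 ^+ m.+2)%:E * \int[leb]_(y in ball x (r x)) g y)%E).
  rewrite big_seq [leRHS]big_seq; apply: lee_sum => x xD.
  have kp : 0 < k.+1%:R^-1 :> R by rewrite invr_gt0.
  have [h1 h2] := (rP x).2 (DS _ xD).
  have := @cube_estimate mu u L t k.+1%:R^-1 x (r x) uL t0 kp (rp x) h1 h2.
  rewrite invrK; apply; apply: (le_trans hk); rewrite lee_fin ler_pM2r ?invr_gt0//.
  by rewrite lerXn2r ?nnegrE ?(ltW r0p) ?(ltW (rp x))//; exact: (rP x).1.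
rewrite -ge0_sume_distrr; last by move=> x _; exact: integral_ge0.
apply: lee_wpmul2l; first by rewrite lee_fin exprn_ge0.
(* Disjointness of the selected cubes turns the sum into one integral over their union. *)
rewrite -ge0_integral_bigsetU//; last exact: measurable_funTS.
apply: ge0_subset_integral => //.
by apply: bigsetU_measurable => x _.
Qed.
End level_sets.

(** * Integration over the levels *)

Lemma limn_einf_ge (R : realType) (f : (\bar R)^nat) (a : \bar R) :
  (\forall k \near \oo, (a <= f k)%E) -> (a <= limn_einf f)%E.
Proof.
move=> [N _ af]; rewrite limn_einf_lim; apply: lime_ge; first exact: is_cvg_einfs.
exists N => // k Nk; apply: le_ereal_inf_tmp => _ [l /= kl <-].
by apply: af; exact: leq_trans kl.
Qed.

Lemma limn_einf_le (R : realType) (f : (\bar R)^nat) (a : \bar R) :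
  (forall k, (f k <= a)%E) -> (limn_einf f <= a)%E.
Proof.
move=> fa; rewrite limn_einf_lim; apply: lime_le; first exact: is_cvg_einfs.
apply: nearW => k; apply: le_trans (fa k).
by apply: ereal_inf_lbound; exists k => /=.
Qed.

Lemma sigma_finite_measure_of d (T : measurableType d) (R : realType)
    (mu : {measure set T -> \bar R}) : sigma_finite setT mu ->
  exists M : {sigma_finite_measure set T -> \bar R}, (M : set T -> \bar R) = mu.
Proof.
move=> sf.
pose m : {measure set T -> \bar R} := mrestr mu (@measurableT _ T).
have mE : (m : set T -> \bar R) = mu by apply/funext => A; rewrite /m /= /mrestr setIT.
have sm : sigma_finite setT m by rewrite mE.
pose sfm := Measure_isSigmaFinite.Build _ _ _ m sm.
pose M : {sigma_finite_measure set T -> \bar R} :=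
  HB.pack (Measure.sort m) (Measure.class m) sfm.
by exists M.
Qed.

Lemma measurable_limn_einf d (T : measurableType d) (R : realType) (D : set T)
    (f : (T -> \bar R)^nat) : (forall k, measurable_fun D (f k)) ->
  measurable_fun D (fun x => limn_einf (f^~ x)).
Proof.
move=> mf; under eq_fun do rewrite limn_einf_lim.
apply: (@emeasurable_fun_cvg _ _ _ _ (fun k x => einfs (f^~ x) k)) => [k|x _].
  exact: measurable_fun_einfs.
exact: is_cvg_einfs.
Qed.

Section weighted_sobolev.
Context {R : realType} {m : nat}.
Local Notation n := m.+1.
Local Notation V := 'rV[R]_n.
Implicit Types (u : V -> R) (x y : V) (mu : {measure set V -> \bar R}).
Local Notation leb := (@lebesgue_rV R n).
Local Notation leb1 := (@lebesgue_measure R).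
Local Notation mR := (measurableTypeR R).

Let halfline : set mR := `]0, +oo[%classic.

Let measurable_halfline : measurable halfline.
Proof. exact: measurable_itv. Qed.

Lemma locally_finite_sigma_finite mu : locally_finite mu -> sigma_finite setT mu.
Proof.
move=> muK; pose B k : 'I_n -> set mR := fun=> `[- k%:R, k%:R]%classic.
exists (fun k => box (B k)) => [|k].
  apply/esym/seteqP; split=> // v _.
  have [k kv] : exists k : nat, `|v| <= k%:R.
    by exists (Num.truncn `|v|).+1; rewrite ltW// truncnS_gt.
  exists k => // i; rewrite /B /= in_itv /= -ler_norml.
  exact: le_trans (ler_coord_norm _ _) kv.
split; first by apply: measurable_box_rV => i; exact: measurable_itv.
by apply: muK; apply: (@rV_compact R n (B k)) => i; exact: segment_compact.
Qed.

(** Tonelli's theorem for the indicator of the region under the graph of [|u|]. *)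
Lemma layer_cake (mu : {sigma_finite_measure set V -> \bar R}) u : continuous u ->
  measurable_fun setT (fun t : mR => mu (superlevel u t)) /\
  (\int[mu]_x `|u x|%:E = \int[leb1]_(t in halfline) mu (superlevel u t))%E.
Proof.
move=> cu; have mu' := measurable_norm_continuous cu.
pose A : set (mR * V) := [set p | p.1 < `|u p.2|].
have mA : measurable A.
  have mA' : measurable_fun setT (fun p : mR * V => p.1 < `|u p.2|).
    by apply: measurable_fun_ltr => //; exact: (measurableT_comp mu' measurable_snd).
  by have := mA' measurableT [set true] ltac:(by []); rewrite setTI.
pose f (p : mR * V) := (\1_A p)%:E : \bar R.
have mf : measurable_fun setT f by apply/measurable_EFinP.
have f0 p : (0 <= f p)%E by rewrite lee_fin.
have fE t : (\int[mu]_x f (t, x) = mu (superlevel u t))%E.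
  rewrite -[in RHS](setIT (superlevel u t)) -integral_indic//.
  exact: measurable_superlevel.
split.
  have := measurable_tonelli_on mu (@measurableT _ V) mf f0.
  by under eq_fun do rewrite fE.
under [RHS]eq_integral do rewrite -fE.
rewrite (tonelli_on _ _ measurable_halfline (@measurableT _ V) mf f0).
apply: eq_integral => x _.
transitivity (\int[leb1]_(t in halfline) (\1_(`]-oo, `|u x|[%classic : set mR) t)%:E)%E.
  rewrite integral_indic//.
  rewrite (_ : _ `&` _ = `]0, `|u x|[%classic); last first.
    apply/seteqP; split=> t; rewrite /halfline /= !in_itv/= ?andbT; first by move=> [-> ->].
    by move=> /andP[-> ->].
  transitivity (leb1 `]0, `|u x|[%classic); last by [].
  rewrite lebesgue_measure_itv/= lte_fin; case: ltP => [_|]; first by rewrite oppr0 adde0.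
  by rewrite normr_le0 => /eqP ->; rewrite normr0.
apply: eq_integral => t _; rewrite /f !indicE; congr ((_ : bool)%:R%:E).
Qed.

Lemma measurable_layer_energy2 u d : continuous u ->
  measurable_fun setT (fun p : mR * V => (d^-1 * layer_energy u p.1 d p.2)%:E).
Proof.
move=> cu; have mu' := measurable_norm_continuous cu.
apply/measurable_EFinP; apply: measurable_funM => //.
have mu2 : measurable_fun setT (fun p : mR * V => `|u p.2|).
  exact: (measurableT_comp mu' measurable_snd).
apply: measurable_fun_if => //.
- apply: measurable_and; apply: measurable_fun_ltr => //.
  exact: measurable_funD.
- apply: measurable_funTS.
  apply: (@measurableT_comp _ _ _ _ _ _ (fun y => \sum_(i < n) abs_partial u i y)) => //.
  by apply: measurable_sum => i; exact: measurable_abs_partial.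
Qed.

(** After exchanging the integrals, for fixed [y] the levels [t] whose layer contains [y] form an
    interval of length [d], which cancels the factor [d^-1]. Restriction to positive levels can only
    decrease the result. *)
Lemma layer_energy_average u (N : V -> \bar R) d : continuous u ->
  measurable_fun setT N -> (forall y, 0 <= N y)%E -> 0 < d ->
  measurable_fun setT
    (fun t : mR => \int[leb]_y ((d^-1 * layer_energy u t d y)%:E * N y))%E /\
  (\int[leb1]_(t in halfline) \int[leb]_y ((d^-1 * layer_energy u t d y)%:E * N y) <=
   \int[leb]_y ((\sum_(i < n) abs_partial u i y)%:E * N y))%E.
Proof.
move=> cu mN N0 d0; have mu' := measurable_norm_continuous cu.
pose f (p : mR * V) := ((d^-1 * layer_energy u p.1 d p.2)%:E * N p.2)%E.
have mf : measurable_fun setT f.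
  apply: emeasurable_funM; first exact: measurable_layer_energy2.
  exact: measurableT_comp.
have f0 p : (0 <= f p)%E.
  apply: mule_ge0 => //; rewrite lee_fin mulr_ge0 ?invr_ge0 ?(ltW d0)//.
  exact: layer_energy_ge0.
split; first exact: (measurable_tonelli_on leb (@measurableT _ V) mf f0).
rewrite (tonelli_on leb1 leb measurable_halfline (@measurableT _ V) mf f0).
pose G y := (\sum_(i < n) abs_partial u i y)%:E.
have G0 y : (0 <= G y)%E.
  by rewrite lee_fin; apply: sumr_ge0 => i _; exact: abs_partial_ge0.
have mG : measurable_fun setT G.
  by apply/measurable_EFinP; apply: measurable_sum => i; exact: measurable_abs_partial.
apply: ge0_le_integral => //.
- by move=> y _; apply: integral_ge0.
- exact: (measurable_tonelli_on2 leb1 measurable_halfline mf f0).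
- exact: emeasurable_funM.
move=> y _.
pose I : set mR := `](`|u y| - d), `|u y|[%classic.
have mI : measurable I by exact: measurable_itv.
have GN0 : (0 <= G y * N y)%E by exact: mule_ge0.
have d10 : 0 <= d^-1 by rewrite invr_ge0 ltW.
have fE t : f (t, y) = ((d^-1)%:E * (G y * N y) * (\1_I t)%:E)%E.
  rewrite /f /layer_energy /= indicE.
  have -> : (t \in I) = (t < `|u y| < t + d).
    apply/idP/idP => [/[!inE]|h]; last rewrite inE; rewrite /I/= in_itv/=.
      by move=> /andP[? ?]; apply/andP; split; lra.
    by move: h => /andP[? ?]; apply/andP; split; lra.
  case: ifP => _; first by rewrite mule1 EFinM muleA.
  by rewrite mulr0 mul0e mule0.
under eq_integral do rewrite fE.
rewrite ge0_integralZl//; last 2 first.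
- by apply/measurable_EFinP.
- by apply: mule_ge0.
rewrite integral_indic//.
apply: (@le_trans _ _ ((d^-1)%:E * (G y * N y) * d%:E)%E).
  apply: lee_wpmul2l; first exact: mule_ge0.
  apply: (@le_trans _ _ (leb1 I)); first by rewrite le_measure ?inE//; exact: measurableI.
  rewrite /I lebesgue_measure_itv/= lte_fin ifT; last by lra.
  by rewrite -EFinD lee_fin; lra.
by rewrite muleAC -EFinM mulVf ?gt_eqF// mul1e.
Qed.

(** The superlevel set is the increasing union of the sets [S j]. Each of them satisfies
    [level_set_estimate] only from some [k] on, depending on [j], and a lower limit in [k] absorbs
    this dependence. *)
Lemma superlevel_liminf mu u L t :
  (forall x y, `|u x - u y| <= L * eucl_norm (x - y)) ->
  compact (closure [set x | u x != 0]) -> 0 <= t ->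
  (mu (superlevel u t) <= limn_einf (fun k => (4 ^+ m.+2)%:E *
    \int[leb]_y ((k.+1%:R * layer_energy u t k.+1%:R^-1 y)%:E * cube_maximal mu y)))%E.
Proof.
move=> uL cs t0; have cu := lip_continuous uL.
pose S j := [set y | t + j.+1%:R^-1 <= `|u y|].
have mS j : measurable (S j).
  rewrite -[X in measurable X]setTI; apply: measurable_fun_le => //.
  exact: measurable_norm_continuous.
have Scup : \bigcup_j S j = superlevel u t.
  apply/seteqP; split=> [y [j _]|y tu].
    by apply: lt_le_trans; rewrite ltrDl invr_gt0.
  have ut0 : 0 < `|u y| - t by rewrite subr_gt0.
  have [k _ /(_ k (leqnn _)) ke] := near_infty_natSinv_lt (PosNum ut0).
  have {}ke : k.+1%:R^-1 < `|u y| - t by [].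
  by exists k => //; rewrite /S /= -lerBrDl ltW.
have cS : mu \o S @ \oo --> mu (superlevel u t).
  rewrite -Scup; apply: nondecreasing_cvg_mu => //.
  - by rewrite Scup; exact: measurable_superlevel.
  - move=> k l kl; apply/subsetPset => y; apply: le_trans.
    by rewrite lerD2l lef_pV2 ?posrE// ler_nat.
apply: (cvge_le _ cS); apply: nearW => j; apply: limn_einf_ge.
by apply: (level_set_estimate mu uL cs t0); rewrite invr_gt0.
Qed.

Lemma weighted_sobolev mu u L : locally_finite mu ->
  (forall x y, `|u x - u y| <= L * eucl_norm (x - y)) ->
  compact (closure [set x | u x != 0]) ->
  (\int[mu]_x `|u x|%:E <= (4 ^+ m.+2)%:E *
    \int[leb]_y ((\sum_(i < n) abs_partial u i y)%:E * cube_maximal mu y))%E.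
Proof.
move=> lf uL cs; have cu := lip_continuous uL.
have [M ME] := sigma_finite_measure_of (locally_finite_sigma_finite lf).
have [mlev lcake] := layer_cake M cu.
rewrite ME in mlev lcake; rewrite lcake {lcake}.
pose Phi k (t : mR) := ((4 ^+ m.+2)%:E *
  \int[leb]_y ((k.+1%:R * layer_energy u t k.+1%:R^-1 y)%:E * cube_maximal mu y))%E.
have C0 : (0 <= (4 ^+ m.+2)%:E :> \bar R)%E by rewrite lee_fin exprn_ge0.
have N0 y := cube_maximal_ge0 mu y.
have kp k : 0 < k.+1%:R^-1 :> R by rewrite invr_gt0.
have Phi1 k t : (0 <= \int[leb]_y
    ((k.+1%:R * layer_energy u t k.+1%:R^-1 y)%:E * cube_maximal mu y))%E.
  apply: integral_ge0 => y _; apply: mule_ge0 => //.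
  by rewrite lee_fin mulr_ge0//; exact: layer_energy_ge0.
have Phi0 k t : (0 <= Phi k t)%E by exact: mule_ge0.
have avg k := layer_energy_average cu (measurable_cube_maximal mu) N0 (kp k).
have mPhi k : measurable_fun setT (Phi k).
  have := (avg k).1; rewrite invrK.
  by move=> ?; exact: measurable_funeM.
apply: (@le_trans _ _ (\int[leb1]_(t in halfline) limn_einf (Phi^~ t))%E).
  apply: ge0_le_integral => //.
  - exact: measurable_funTS.
  - by apply: measurable_funTS; exact: measurable_limn_einf.
  move=> t; rewrite /halfline/= in_itv/= andbT => t0.
  exact: (superlevel_liminf mu uL cs (ltW t0)).
apply: (le_trans (fatou _ _ _ _)) => //; first by move=> k; exact: measurable_funTS.
(* After Fatou's lemma, [layer_energy_average] gives a bound that is the same for all [k], hence a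
   bound for the lower limit. *)
apply: limn_einf_le => k; rewrite ge0_integralZl//; last first.
  have := (avg k).1; rewrite invrK.
  exact: measurable_funTS.
apply: lee_wpmul2l => //.
by have := (avg k).2; rewrite invrK.
Qed.

End weighted_sobolev.

(** * Return from cubes and partial derivatives to Euclidean balls and the gradient *)

Theorem theorem2p1 (R : realType) (n : nat) (hn : (2 <= n)%N) :
  exists C : R,
    forall mu : {measure set 'rV[R]_n -> \bar R}, locally_finite mu ->
    forall u : 'rV[R]_n -> R, lip_c u ->
    (\int[mu]_x (`|u x|)%:E <=
     C%:E * \int[lebesgue_rV]_x
              ((eucl_norm (grad u x))%:E * frac_maximal 1 mu x))%E.
Proof.
case: n hn => [//|m] _.
(* The first factor compares the sum of the partial derivatives with the Euclidean norm of the
   gradient, the second is the constant of [cube_maximal_le]. *)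
pose K : R := m.+1%:R * (2 ^+ m.+1 * m.+1%:R ^+ m).
have K0 : 0 < K by rewrite !mulr_gt0// exprn_gt0.
exists (4 ^+ m.+2 * K) => mu lf u [[L uL] cs].
apply: (le_trans (weighted_sobolev lf uL cs)).
rewrite [(_ * K)%:E]EFinM -muleA; apply: lee_wpmul2l; first by rewrite lee_fin exprn_ge0.
have cu := lip_continuous uL.
set G := fun y => ((\sum_(i < m.+1) abs_partial u i y)%:E * cube_maximal mu y)%E.
have S0 y : 0 <= \sum_(i < m.+1) abs_partial u i y.
  by apply: sumr_ge0 => i _; exact: abs_partial_ge0.
have G0 y : (0 <= G y)%E.
  by apply: mule_ge0; [rewrite lee_fin|exact: cube_maximal_ge0].
have mG : measurable_fun setT G.
  apply: emeasurable_funM; last exact: measurable_cube_maximal.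
  by apply/measurable_EFinP; apply: measurable_sum => i; exact: measurable_abs_partial.
have KV0 : (0 <= (K^-1)%:E)%E by rewrite lee_fin invr_ge0 ltW.
(* The constant is taken out of the integral of [G], which is known to be measurable, rather than
   out of the integral with [grad u]. *)
have -> : (\int[lebesgue_rV]_y G y = K%:E * \int[lebesgue_rV]_y ((K^-1)%:E * G y))%E.
  rewrite ge0_integralZl//.
  by rewrite muleA -EFinM divff ?gt_eqF// mul1e.
apply: lee_wpmul2l; first by rewrite lee_fin ltW.
apply: ge0_le_integral_measurable_left => [y|y]; first exact: mule_ge0.
have -> : ((eucl_norm (grad u y))%:E * frac_maximal 1 mu y = (K^-1)%:E *
    (K%:E * ((eucl_norm (grad u y))%:E * frac_maximal 1 mu y)))%E.
  by rewrite [RHS]muleA -EFinM mulVf ?gt_eqF// mul1e.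
apply: lee_wpmul2l => //.
rewrite /K EFinM muleACA.
apply: lee_pmul => //; [by rewrite lee_fin|exact: cube_maximal_ge0| |].
  rewrite -EFinM lee_fin -[X in X%:R]card_ord -sumr_const mulr_suml.
  by apply: ler_sum => i _; rewrite mul1r; exact: abs_partial_le_grad.
exact: cube_maximal_le.
Qed.
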